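(* Let $A\in\mathbb{R}^{d\times d}$, $B\in\mathbb{R}^{d\times m}$ and consider the linear control system $\dot x(t)=Ax(t)+B\omega(t)$, $\omega\in\mathcal{U}$, on $\mathbb{R}^d$. Assume that $(A,B)$ is controllable (i.e. $\operatorname{rank}[B\ AB\ \cdots\ A^{d-1}B]=d$), that $A$ is hyperbolic (no eigenvalues on the imaginary axis), and that the control range $U$ is a compact neighborhood of the origin in $\mathbb{R}^m$. Let $D$ be the unique control set with nonempty interior, let $f\in C(U,\mathbb{R})$, and suppose that $\min_{u\in U}f(u)=f(\omega_0)$ for some $\omega_0\in\mathrm{int}\,U$ and that there exists $x_0\in\mathrm{int}\,D$ with $Ax_0+B\omega_0=0$. Then for every compact set $K\subset D$ with nonempty interior, $(K,D)$ is an admissible pair and $$P_{inv}(f,K,D)=\sum_{\lambda\in\sigma(A)}\max\{0,n_\lambda\operatorname{Re}(\lambda)\}+f(\omega_0),$$ where $n_\lambda$ is the algebraic multiplicity of the eigenvalue $\lambda$.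
   Context: $\mathcal{U}$ is the set of measurable functions $\omega:\mathbb{R}\to U$, where $U\subset\mathbb{R}^m$ is compact (the control range). The trajectory is $\varphi(t,x,\omega)=e^{tA}x+\int_0^te^{(t-s)A}B\omega(s)\,ds$, $t\ge0$. $C(U,\mathbb{R})$ is the set of continuous functions $U\to\mathbb{R}$. The positive orbit of $x$ is $\mathcal{O}^+(x)=\{y:\ \exists\,t>0,\ \omega\in\mathcal{U}\text{ with }\varphi(t,x,\omega)=y\}$. A set $Q$ is controlled invariant if for all $x\in Q$ there is $\omega\in\mathcal{U}$ with $\varphi(t,x,\omega)\in Q$ for all $t\ge0$. A control set is a controlled invariant set $D$ with $D\subset\overline{\mathcal{O}^+(x)}$ for all $x\in D$ that is maximal (with respect to inclusion) among controlled invariant sets with this property. Known fact: under the stated controllability assumption and with $U$ a compact neighborhood of the origin, there is exactly one control set $D$ with nonempty interior. A pair $(K,Q)$ of nonempty sets is admissible if $K$ is compact and for each $x\in K$ there is $\omega\in\mathcal{U}$ with $\varphi(\mathbb{R}_+,x,\omega)\subset Q$ (where $\mathbb{R}_+=[0,\infty)$). For $\tau>0$, a set $\mathcal{S}\subset\mathcal{U}$ is $(\tau,K,Q)$-spanning if for all $x\in K$ there is $\omega\in\mathcal{S}$ with $\varphi(t,x,\omega)\in Q$ for all $t\in[0,\tau]$. With $(S_\tau f)(\omega)=\int_0^\tau f(\omega(t))\,dt$, put $$a_\tau(f,K,Q)=\inf\Big\{\sum_{\omega\in\mathcal{S}}e^{(S_\tau f)(\omega)};\ \mathcal{S}\ (\tau,K,Q)\text{-spanning}\Big\}\in[0,\infty],\qquad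 P_{inv}(f,K,Q)=\limsup_{\tau\to\infty}\frac1\tau\log a_\tau(f,K,Q).$$ $\sigma(A)$ denotes the set of (distinct, complex) eigenvalues of $A$. *)

(* Defs.v *)
From mathcomp Require Import all_boot all_order all_algebra.
From mathcomp Require Import all_classical all_reals all_analysis.
From mathcomp Require Import complex.
Set Implicit Arguments.
Unset Strict Implicit.
Unset Printing Implicit Defensive.
Import Order.TTheory GRing.Theory Num.Theory.
Import numFieldNormedType.Exports.
Local Open Scope classical_set_scope.
Local Open Scope ring_scope.

Section LinearControlSystem.
Context {R : realType} {d m : nat}.
Implicit Types (A : 'M[R]_d) (B : 'M[R]_(d, m)) (U : set 'cV[R]_m)
  (K Q D : set 'cV[R]_d) (x y : 'cV[R]_d) (w : R -> 'cV[R]_m)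
  (f : 'cV[R]_m -> R) (t tau : R).

Local Notation mu := (@lebesgue_measure R).

Definition expmx A : 'M[R]_d :=
  limn (series (fun k => (k`!%:R)^-1 *: A ^+ k)).

(* Borel measurability on both sides: a Lebesgue-measurable control agrees almost
   everywhere with a Borel one, and hence yields the same trajectories. *)
Definition controls U : set (R -> 'cV[R]_m) :=
  [set w | measurable_fun [set: R]
             (w : R -> g_sigma_algebraType (@open 'cV[R]_m))
           /\ forall t, U (w t)].

Definition trajectory A B t x w : 'cV[R]_d :=
  expmx (t *: A) *m x +
  \col_i (\int[mu]_(s in `[0, t]) (expmx ((t - s) *: A) *m B *m w s) i 0)%R.

Definition positive_orbit A B U x : set 'cV[R]_d :=
  [set y | exists t, exists w,
     [/\ 0 < t, controls U w & trajectory A B t x w = y]].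

Definition controlled_invariant A B U Q :=
  forall x, Q x -> exists2 w, controls U w &
    forall t, 0 <= t -> Q (trajectory A B t x w).

Definition control_set_prop A B U D :=
  controlled_invariant A B U D /\
  forall x, D x -> D `<=` closure (positive_orbit A B U x).

Definition control_set A B U D :=
  control_set_prop A B U D /\
  forall D', control_set_prop A B U D' -> D `<=` D' -> D' = D.

Definition admissible A B U K Q :=
  [/\ K !=set0, Q !=set0, compact K &
   forall x, K x -> exists2 w, controls U w &
     forall t, 0 <= t -> Q (trajectory A B t x w)].

Definition spanning A B U tau K Q (S : set (R -> 'cV[R]_m)) :=
  S `<=` controls U /\
  forall x, K x -> exists2 w, S w &
    forall t, 0 <= t <= tau -> Q (trajectory A B t x w).

Definition potential_sum tau f w : R := (\int[mu]_(t in `[0, tau]) f (w t))%R.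

(* \esum is the supremum of the finite partial sums, so S may be uncountable. *)
Definition inv_pressure_at A B U tau f K Q : \bar R :=
  ereal_inf [set (\esum_(w in S) (expR (potential_sum tau f w))%:E)%E
            | S in spanning A B U tau K Q].

Definition inv_pressure A B U f K Q : \bar R :=
  limf_esup (fun tau => (tau^-1)%:E * lne (inv_pressure_at A B U tau f K Q))%E
            (pinfty_nbhs R).

Definition complexify A : 'M[R[i]]_d :=
  map_mx (real_complex R) A.

Definition spectrum A : set R[i] :=
  [set l | eigenvalue (complexify A) l].

Definition alg_mult A (l : complex R) : nat :=
  mup l (char_poly (complexify A)).

Definition hyperbolic A := forall l, spectrum A l -> complex.Re l != 0.

Definition controllable A B :=
  \rank (\mxrow_(k < d) (A ^+ k *m B)) = d.

End LinearControlSystem.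

(* Main.v *)
From HB Require Import structures.
Require Import Defs.
From mathcomp Require Import all_boot all_order all_algebra.
From mathcomp Require Import all_classical all_reals all_analysis.
From mathcomp Require Import measurable_realfun complex ring lra.
Import Order.TTheory GRing.Theory Num.Theory.
Import numFieldNormedType.Exports.
Import ComplexField.Normc.
Local Open Scope classical_set_scope.
Local Open Scope ring_scope.

(**
  Conjugate [A] over the complex numbers to a triangular matrix, with the
  eigenvalues on the diagonal; the diagonal entries of [exp (t A)] then have
  modulus [exp (t Re lambda)].

  Lower bound.  Take a grid in a small complex polydisc, with [c max(1, |mu_j|)]
  steps along the real and along the imaginary axis of the [j]-th coordinate,
  [mu_j] being the [j]-th diagonal entry of [exp (tau A)].  By triangularity,
  [exp (tau A)] moves distinct grid points further apart than the diameter of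
  [D], which is bounded because [A] is hyperbolic.  Since the real and imaginary
  parts of a grid point are steered by one control each, the square of the size
  of a spanning set is at least the number of grid points, and each of its
  controls costs at least [exp (tau f w0)].

  Upper bound.  Rescaling the triangular basis makes the off-diagonal part of
  [exp (t A)] negligible, so that the image of the unit polydisc is covered by
  [prod_j (9 max(1, |mu_j|))^2] translates of it.  Iterating, and passing back to
  real vectors by counting pairs of separated real points, one covers
  [exp (tau A) K1] by at most [exp (tau (h + e))] translates of a convex
  neighbourhood [K1] of the origin, where [h] is the sum over the eigenvalues.
  Controllability gives for each translate a control that carries its part of
  [K1] back into [K1].  After scaling [K1] down, these controls take values near
  [w0] and keep the trajectories near [x0].  Concatenating such controls, after
  finitely many controls that steer [K] to [x0] inside [D], gives the spanning
  sets.
*)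

Set Implicit Arguments.
Unset Strict Implicit.
Unset Printing Implicit Defensive.

(** * The matrix exponential *)

Section MatrixNorm.
Context {R : realType}.

Lemma mx_norm_entry p q (M : 'M[R]_(p, q)) i j : `|M i j| <= `|M|.
Proof.
rewrite [leRHS]/Num.Def.normr /= mx_normrE.
by apply/bigmax_geP; right; exists (i, j).
Qed.

Lemma mx_norm_le p q (M : 'M[R]_(p, q)) c :
  0 <= c -> (forall i j, `|M i j| <= c) -> `|M| <= c.
Proof.
move=> c0 Mc; rewrite [leLHS]/Num.Def.normr /= mx_normrE.
by apply/bigmax_leP; split => // -[i j] _; exact: Mc.
Qed.

(** The norm is the largest modulus of an entry, hence submultiplicative only up to the inner
    dimension. *)
Lemma mx_norm_mul p q r (M : 'M[R]_(p, q)) (N : 'M[R]_(q, r)) :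
  `|M *m N| <= q%:R * `|M| * `|N|.
Proof.
apply: mx_norm_le => [|i j]; first by rewrite !mulr_ge0.
rewrite mxE; apply: (le_trans (ler_norm_sum _ _ _)).
have -> : q%:R * `|M| * `|N| = \sum_(k < q) (`|M| * `|N|).
  by rewrite sumr_const card_ord -mulrA mulr_natl.
by apply: ler_sum => k _; rewrite normrM ler_pM // mx_norm_entry.
Qed.

Lemma mulmx_entry p q r (M : 'M[R]_(p, q)) (N : 'M[R]_(q, r)) i j :
  (M *m N) i j = \sum_l M i l * N l j.
Proof. by rewrite mxE. Qed.

Lemma cvg_mx_entry p q (T : Type) (F : set_system T) (FF : Filter F)
  (f : T -> 'M[R]_(p, q)) (L : 'M[R]_(p, q)) :
  (forall i j, (fun t => f t i j) @ F --> L i j) -> f @ F --> L.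
Proof.
move=> fL; apply/cvgrPdist_le => e e0.
have H : \forall t \near F, forall ij : 'I_p * 'I_q, `|L ij.1 ij.2 - f t ij.1 ij.2| <= e.
  by apply: filter_forall => -[i j]; have /cvgrPdist_le/(_ e e0) := fL i j.
apply: filterS H => t H; apply: mx_norm_le; first exact: ltW.
by move=> i j; rewrite !mxE; exact: (H (i, j)).
Qed.

Lemma cvg_sumr (T : Type) (F : set_system T) (FF : Filter F) (I : finType)
    (f : I -> T -> R) (l : I -> R) :
  (forall i, f i t @[t --> F] --> l i) ->
  \sum_i f i t @[t --> F] --> \sum_i l i.
Proof.
move=> fl; apply: cvg_big => [|i _]; last exact: fl.
exact: add_continuous.
Qed.

End MatrixNorm.

(** * Power series of the exponential and its group law *)

Section Exponential.
Context {R : realType} {d : nat}.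
Implicit Types (A : 'M[R]_d) (t s : R).

(** Each entry of the exponential is treated as a scalar power series in [t] with these
    coefficients, so that termwise differentiation of power series applies. *)
Let coef A i j (k : nat) : R := (A ^+ k) i j / k`!%:R.

Lemma exprmxS A k : A ^+ k.+1 = A *m A ^+ k.
Proof. exact: exprS. Qed.

Lemma exprmxD A k l : A ^+ (k + l) = A ^+ k *m A ^+ l.
Proof. exact: exprD. Qed.

Lemma exprmxZ A t k : (t *: A) ^+ k = t ^+ k *: A ^+ k.
Proof.
elim: k => [|k IH]; first by rewrite !expr0 scale1r.
by rewrite !exprmxS IH -scalemxAl -scalemxAr scalerA exprS.
Qed.

Lemma exprmx_entry_le A k i j : `|(A ^+ k) i j| <= (d%:R * `|A|) ^+ k.
Proof.
elim: k i j => [|k IH] i j.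
  by rewrite !expr0 mxE; case: eqP => _; rewrite ?normr1 ?normr0.
rewrite exprS mxE; apply: (le_trans (ler_norm_sum _ _ _)).
have -> : (d%:R * `|A|) ^+ k.+1 = \sum_(l < d) (`|A| * (d%:R * `|A|) ^+ k).
  by rewrite sumr_const card_ord exprS -mulrA mulr_natl.
by apply: ler_sum => l _; rewrite normrM ler_pM // mx_norm_entry.
Qed.

Let coef_cvg A i j t : cvgn (pseries (coef A i j) t).
Proof.
apply: normed_cvg; apply: (@series_le_cvg _ _ (exp_coeff (d%:R * `|A| * `|t|))) => //.
- by move=> n; exact: normr_ge0.
- by move=> n; rewrite /exp_coeff /= divr_ge0// exprn_ge0// !mulr_ge0.
- move=> n; rewrite /exp_coeff /= /coef !normrM normrX exprMn.
  rewrite [leRHS]mulrAC ler_wpM2r ?exprn_ge0// normfV normr_nat ler_wpM2r//.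
  exact: exprmx_entry_le.
- exact: is_cvg_series_exp_coeff.
Qed.

Lemma expmx_entry A t i j :
  expmx (t *: A) i j = limn (pseries (coef A i j) t).
Proof.
rewrite /expmx; set L := \matrix_(i, j) limn (pseries (coef A i j) t).
suff : series (fun k => (k`!%:R)^-1 *: (t *: A) ^+ k) @ \oo --> L.
  by move=> /cvg_lim ->//; rewrite mxE.
apply: cvg_mx_entry => a b; rewrite mxE.
have -> : (fun n => series (fun k => (k`!%:R)^-1 *: (t *: A) ^+ k) n a b) =
    pseries (coef A a b) t; last exact: coef_cvg.
apply/funext => n; rewrite /pseries /series /= summxE; apply: eq_bigr => k _.
by rewrite exprmxZ !mxE /coef; ring.
Qed.

Let pseries_diffs_coef A i j :
  pseries_diffs (coef A i j) = (fun k => (A ^+ k.+1) i j / k`!%:R).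
Proof.
apply/funext => k; rewrite /pseries_diffs /coef factS natrM invfM.
by rewrite mulrCA; congr (_ * _); rewrite mulVKf.
Qed.

(** The [n]-fold termwise derivative of the entry series. The factor [A ^+ n] comes out of each
    partial sum as a finite sum over a row, so convergence and value follow from the
    undifferentiated series. *)
Let limn_shift A i j t n :
  cvgn (pseries (fun k => (A ^+ (n + k)) i j / k`!%:R) t) /\
  limn (pseries (fun k => (A ^+ (n + k)) i j / k`!%:R) t) =
  (A ^+ n *m expmx (t *: A)) i j.
Proof.
suff : pseries (fun k => (A ^+ (n + k)) i j / k`!%:R) t @ \oo -->
  (A ^+ n *m expmx (t *: A)) i j.
  by move=> h; split; [exact: cvgP h|exact: cvg_lim h].
have -> : pseries (fun k => (A ^+ (n + k)) i j / k`!%:R) t =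
    (fun m => \sum_(l < d) (A ^+ n) i l * pseries (coef A l j) t m).
  apply/funext => m; rewrite /pseries /series /=.
  under [RHS]eq_bigr do rewrite mulr_sumr.
  rewrite exchange_big /=; apply: eq_bigr => k _.
  by rewrite exprmxD mxE -mulrA mulr_suml; apply: eq_bigr => l _; rewrite /coef; ring.
rewrite mxE. apply: cvg_sumr => l. apply: cvgMl_tmp.
by rewrite expmx_entry; exact: coef_cvg.
Qed.

Lemma is_derive_expmx A t i j :
  is_derive t (1 : R) (fun t => expmx (t *: A) i j) ((A *m expmx (t *: A)) i j).
Proof.
have H1 : pseries_diffs (coef A i j) = (fun k => (A ^+ (1 + k)) i j / k`!%:R).
  by rewrite pseries_diffs_coef.
have H2 : pseries_diffs (pseries_diffs (coef A i j)) =
    (fun k => (A ^+ (2 + k)) i j / k`!%:R).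
  rewrite pseries_diffs_coef; apply/funext => k; rewrite /pseries_diffs factS natrM invfM.
  by rewrite mulrCA; congr (_ * _); rewrite mulVKf.
have -> : (fun t => expmx (t *: A) i j) = (fun t => limn (pseries (coef A i j) t)).
  by apply/funext => s; rewrite expmx_entry.
have -> : (A *m expmx (t *: A)) i j = limn (pseries (pseries_diffs (coef A i j)) t).
  by rewrite H1 (limn_shift A i j t 1).2 expr1.
(* Termwise differentiation at [t] asks for convergence of the series and of its first two formal
   derivatives at a point of larger modulus. *)
apply: (@pseries_snd_diffs _ _ (`|t| + 1)).
- exact: coef_cvg.
- by rewrite H1; exact: (limn_shift A i j _ 1).1.
- by rewrite H2; exact: (limn_shift A i j _ 2).1.
- by rewrite [ltRHS]ger0_norm ?addr_ge0// ltrDl.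
Qed.

Lemma expmx_cvg_entry A t i j :
  series (fun k => (k`!%:R)^-1 *: (t *: A) ^+ k) n i j @[n --> \oo] -->
  expmx (t *: A) i j.
Proof.
have -> : (fun n => series (fun k => (k`!%:R)^-1 *: (t *: A) ^+ k) n i j) =
    pseries (coef A i j) t; last by rewrite expmx_entry; exact: coef_cvg.
apply/funext => n; rewrite /pseries /series /= summxE; apply: eq_bigr => k _.
by rewrite exprmxZ !mxE /coef; ring.
Qed.

(** A linear functional is a finite combination of entries, hence passes to the limit of the partial
    sums, which are combinations of powers of [A]. Linear relations satisfied by all powers, such as
    commuting with [A] or a zero entry, thus carry over to the exponential. *)
Lemma expmx_lin0 A t (f : 'M[R]_d -> R) : scalar f ->
  (forall k, f (A ^+ k) = 0) -> f (expmx (t *: A)) = 0.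
Proof.
move=> lf LA.
pose L : {scalar 'M[R]_d} := HB.pack f (GRing.isLinear.Build _ _ _ _ f lf).
rewrite -[f]/(L : _ -> _) in LA *.
have LE X : L X = \sum_(ij : 'I_d * 'I_d) L (delta_mx ij.1 ij.2) * X ij.1 ij.2.
  rewrite {1}[X]matrix_sum_delta pair_big linear_sum.
  by apply: eq_bigr => -[i j] _; rewrite linearZ mulrC.
have : L (series (fun k => (k`!%:R)^-1 *: (t *: A) ^+ k) n) @[n --> \oo] --> L (expmx (t *: A)).
  rewrite LE; under eq_fun do rewrite LE.
  apply: cvg_sumr => -[i j]; apply: cvgMl_tmp => /=.
  exact: expmx_cvg_entry.
under eq_fun => n.
  rewrite /series linear_sum big1; last first.
    by move=> k _; rewrite exprmxZ !linearZ LA /= !mulr0.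
  over.
by move=> /cvg_lim <- //; rewrite lim_cst.
Qed.

Lemma expmx_comm A t : A *m expmx (t *: A) = expmx (t *: A) *m A.
Proof.
apply/matrixP => i j; apply/eqP; rewrite -subr_eq0; apply/eqP.
pose f X : R := (A *m X) i j - (X *m A) i j.
have lf : scalar f.
  move=> a u v; rewrite /f !(mulmxDr, mulmxDl) -!scalemxAr -!scalemxAl !mxE.
  by rewrite /=; ring.
apply: (@expmx_lin0 A t f) => // k; rewrite /f.
by rewrite -exprmxS -addn1 exprmxD expr1 subrr.
Qed.
Lemma expmx0 A : expmx (0 *: A) = 1%:M.
Proof.
apply/matrixP => i j; have := @expmx_cvg_entry A 0 i j.
move=> /cvg_lim <- //; apply/cvg_lim => //; rewrite -(cvg_shiftn 1) /=.
under eq_fun => n.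
  rewrite /series /= addn1 summxE big_nat_recl// big1 ?addr0; last first.
    by move=> k _; rewrite exprmxZ exprS mul0r scale0r scaler0 mxE.
  rewrite exprmxZ !expr0 fact0 invr1 !scale1r; over.
exact: cvg_cst.
Qed.

Lemma is_derive_expmx_comp A (g : R -> R) (c t : R) i j :
  is_derive t (1 : R) g c ->
  is_derive t (1 : R) (fun t => expmx (g t *: A) i j)
    (c * (A *m expmx (g t *: A)) i j).
Proof.
move=> dg; rewrite mulrC.
have D := is_derive_expmx A (g t) i j.
exact: (@is_derive1_comp _ (fun t => expmx (t *: A) i j) g _ _ _ D dg).
Qed.

(** The derivative of the left side in [s] vanishes because [A] commutes with its exponential, and
    at [s = 0] both sides agree. Inverse and group law both follow from this identity. *)
Lemma expmx_cancel A s t :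
  expmx (- s *: A) *m expmx ((s + t) *: A) = expmx (t *: A).
Proof.
apply/matrixP => i j.
pose H u := (expmx (- u *: A) *m expmx ((u + t) *: A)) i j.
have H0 : H 0 = expmx (t *: A) i j by rewrite /H oppr0 expmx0 mul1mx add0r.
rewrite -[LHS]/(H s) -H0; apply: is_derive_0_is_cst => u.
have -> : H = \sum_(l < d) ((fun u => expmx (- u *: A) i l) *
   (fun u => expmx ((u + t) *: A) l j)).
  by apply/funext => v; rewrite /H mxE fct_sumE.
have D l : is_derive u (1 : R) ((fun u => expmx (- u *: A) i l) *
     (fun u => expmx ((u + t) *: A) l j))
   (expmx (- u *: A) i l * (A *m expmx ((u + t) *: A)) l j +
    - (A *m expmx (- u *: A)) i l * expmx ((u + t) *: A) l j).
  have D1 : is_derive u (1 : R) (fun u => expmx (- u *: A) i l)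
      (- (A *m expmx (- u *: A)) i l).
    rewrite -[X in is_derive _ _ _ X]mulN1r; apply: (@is_derive_expmx_comp A -%R).
  have D2 : is_derive u (1 : R) (fun u => expmx ((u + t) *: A) l j)
      ((A *m expmx ((u + t) *: A)) l j).
    rewrite -[X in is_derive _ _ _ X]mul1r; apply: (@is_derive_expmx_comp A (fun u => u + t)).
    have := @is_deriveD _ _ _ id (cst t) u 1 1 0 (is_derive_id _ _) (is_derive_cst _ _ _).
    by rewrite addr0.
  by apply: is_derive_eq; rewrite /GRing.scale /=; ring.
apply: is_derive_eq.
transitivity ((expmx (- u *: A) *m (A *m expmx ((u + t) *: A))) i j
   - ((A *m expmx (- u *: A)) *m expmx ((u + t) *: A)) i j).
  rewrite !(mulmx_entry _ _ i j) -sumrB; apply: eq_bigr => l _.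
  by rewrite mulNr.
by rewrite (expmx_comm A (- u)) -mulmxA subrr.
Qed.

Lemma expmxVK A t : expmx (- t *: A) *m expmx (t *: A) = 1%:M.
Proof. by have := expmx_cancel A t 0; rewrite addr0 expmx0. Qed.

Lemma expmxKV A t : expmx (t *: A) *m expmx (- t *: A) = 1%:M.
Proof. by have := expmxVK A (- t); rewrite opprK. Qed.

Lemma expmxD A s t : expmx ((s + t) *: A) = expmx (s *: A) *m expmx (t *: A).
Proof. by rewrite -(expmx_cancel A s t) mulmxA expmxKV mul1mx. Qed.

Lemma continuous_expmx A i j : continuous (fun t => expmx (t *: A) i j).
Proof.
move=> t; apply: differentiable_continuous; apply/derivable1_diffP.
by have [] := is_derive_expmx A t i j.
Qed.

Lemma expmx_norm A t : `|expmx (t *: A)| <= expR (d%:R * `|A| * `|t|).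
Proof.
apply: mx_norm_le => [|i j]; first exact: expR_ge0.
have C := @coef_cvg A i j t; rewrite expmx_entry.
have H n : `|pseries (coef A i j) t n| <= expR (d%:R * `|A| * `|t|).
  apply: (le_trans (ler_norm_sum _ _ _)).
  apply: (@le_trans _ _ (series (exp_coeff (d%:R * `|A| * `|t|)) n)); last first.
    apply: nondecreasing_cvgn_le; last exact: is_cvg_series_exp_coeff.
    apply: nondecreasing_series => k _ _.
    by rewrite /exp_coeff /= divr_ge0// exprn_ge0// !mulr_ge0.
  apply: ler_sum => k _; rewrite /exp_coeff /= /coef !normrM normrX exprMn.
  rewrite [leRHS]mulrAC ler_wpM2r ?exprn_ge0// normfV normr_nat ler_wpM2r//.
  exact: exprmx_entry_le.
rewrite ler_norml; apply/andP; split.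
  apply: limr_ge => //; apply: nearW => n.
  by have := H n; rewrite ler_norml => /andP[].
apply: limr_le => //; apply: nearW => n.
by have := H n; rewrite ler_norml => /andP[].
Qed.

End Exponential.

(** * Complex triangularization *)

Section Triangular.
Context {C : comNzRingType} {d : nat}.

Lemma trigmx_mul (S T : 'M[C]_d) : is_trig_mx S -> is_trig_mx T -> is_trig_mx (S *m T).
Proof.
move=> /is_trig_mxP hS /is_trig_mxP hT; apply/is_trig_mxP => i j ij.
rewrite mxE big1 // => k _; have [ik|ki] := ltnP i k; first by rewrite hS ?mul0r.
by rewrite (hT _ _ (leq_ltn_trans ki ij)) mulr0.
Qed.

Lemma trigmx_mul_diag (S T : 'M[C]_d) i : is_trig_mx S -> is_trig_mx T ->
  (S *m T) i i = S i i * T i i.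
Proof.
move=> /is_trig_mxP hS /is_trig_mxP hT.
rewrite mxE (bigD1 i) //= big1 ?addr0 // => k ki.
have [ik|ik] := ltnP i k; first by rewrite hS ?mul0r.
by rewrite hT ?mulr0 // ltn_neqAle ik andbT; exact: ki.
Qed.

Lemma trigmx1 : is_trig_mx (1%:M : 'M[C]_d).
Proof. by apply/is_trig_mxP => i j ij; rewrite mxE; case: eqP ij => // ->; rewrite ltnn. Qed.

Lemma trigmx_exp (T : 'M[C]_d) k : is_trig_mx T -> is_trig_mx (T ^+ k).
Proof.
move=> hT; elim: k => [|k IH]; first exact: trigmx1.
by rewrite exprS; apply: trigmx_mul.
Qed.

End Triangular.

Section CharPoly.
Context {F : fieldType} {d : nat}.

Lemma char_poly_conj (P A : 'M[F]_d) : P \in unitmx ->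
  char_poly (P *m A *m invmx P) = char_poly A.
Proof.
move=> Pu; rewrite /char_poly.
have -> : char_poly_mx (P *m A *m invmx P) =
    map_mx polyC P *m char_poly_mx A *m map_mx polyC (invmx P).
  rewrite /char_poly_mx mulmxBr mulmxBl !map_mxM; congr (_ - _).
  rewrite -scalemx1 -scalemxAr mulmx1 -scalemxAl -map_mxM mulmxV //.
  by rewrite map_mx1.
rewrite !det_mulmx mulrAC -det_mulmx -map_mxM mulmxV //.
by rewrite map_mx1 det1 mul1r.
Qed.

End CharPoly.

Section Triangularization.
Context {R : realType} {d : nat}.
Implicit Types (A : 'M[R]_d) (P : 'M[R[i]]_d).

(** Schur triangularization by a unitary matrix. Triangular means lower triangular throughout:
    entries with row index below the column index vanish. *)
Lemma complexify_trig A :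
  exists2 P : 'M[R[i]]_d, P \in unitmx & is_trig_mx (P *m complexify A *m invmx P).
Proof.
have [|P Pu /=] := @spectral.cotrigonalization _ _ [:: complexify A].
  by move=> X Y; rewrite !inE => /eqP -> /eqP ->; exact: comm_mx_refl.
rewrite andbT => h; exists P; first exact: spectral.unitarymx_unit.
by move: h; rewrite /mxred.similar_to /= spectral.conjymx // spectral.invmx_unitary.
Qed.

(** The characteristic polynomial is the product of the factors ['X - T j j], so the diagonal lists
    each eigenvalue as often as its algebraic multiplicity. The estimates below work with the sum
    over the diagonal. *)
Lemma spectrum_sum A P : P \in unitmx ->
  let T := P *m complexify A *m invmx P in is_trig_mx T ->
  \sum_(l \in spectrum A) Num.max 0 ((alg_mult A l)%:R * complex.Re l) =
  \sum_(j < d) Num.max 0 (complex.Re (T j j)).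
Proof.
move=> Pu T hT; set s := [seq T j j | j <- enum 'I_d].
have cpE : char_poly (complexify A) = \prod_(x <- s) ('X - x%:P).
  by rewrite -(char_poly_conj (complexify A) Pu) char_poly_trig // big_map big_enum.
have -> : spectrum A = [set` undup s].
  apply/seteqP; split => l; rewrite /spectrum /= eigenvalue_root_char cpE root_prod_XsubC.
    by rewrite mem_undup.
  by rewrite mem_undup.
rewrite -fsbig_seq ?undup_uniq //.
transitivity (\sum_(x <- s) Num.max 0 (complex.Re x)); last by rewrite /s big_map big_enum.
rewrite -[in RHS]big_undup_iterop_count; apply: eq_bigr => l _.
rewrite /alg_mult cpE mu_prod_XsubC.
rewrite -[RHS]/(Num.max 0 (complex.Re l) *+ count_mem l s) -[RHS]mulr_natl.
by rewrite maxr_pMr // mulr0.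
Qed.

End Triangularization.

Section ComplexConjugation.
Context {R : realType} {d : nat}.
Variable P : 'M[R[i]]_d.
Hypothesis Pu : P \in unitmx.

Definition conj_cplx (X : 'M[R]_d) : 'M[R[i]]_d := P *m complexify X *m invmx P.

Lemma conj_cplxM X Y : conj_cplx (X *m Y) = conj_cplx X *m conj_cplx Y.
Proof.
rewrite /conj_cplx /complexify map_mxM !mulmxA; congr (_ *m _ *m _).
by rewrite -[in RHS]mulmxA mulVmx // mulmx1.
Qed.

Lemma conj_cplx1 : conj_cplx 1%:M = 1%:M.
Proof. by rewrite /conj_cplx /complexify map_mx1 mulmx1 mulmxV. Qed.

Lemma conj_cplxX X k : conj_cplx (X ^+ k) = conj_cplx X ^+ k.
Proof.
elim: k => [|k IH]; first exact: conj_cplx1.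
by rewrite !exprmxS conj_cplxM IH [in RHS]exprS.
Qed.

Lemma conj_cplx_linear a X Y i j :
  conj_cplx (a *: X + Y) i j = a%:C%C * conj_cplx X i j + conj_cplx Y i j.
Proof.
by rewrite /conj_cplx /complexify map_mxD map_mxZ mulmxDr mulmxDl
  -scalemxAr -scalemxAl !mxE.
Qed.

End ComplexConjugation.

Section ExponentialTriangular.
Context {R : realType} {d : nat}.
Implicit Types X Y : 'M[R]_d.
Variables (A : 'M[R]_d) (P : 'M[R[i]]_d).
Hypothesis Pu : P \in unitmx.
Hypothesis hT : is_trig_mx (conj_cplx P A).
Local Notation conj_cplx := (conj_cplx P).

Lemma is_derive_expmx_scalar (f : 'M[R]_d -> R) t : scalar f ->
  is_derive t (1 : R) (fun t => f (expmx (t *: A))) (f (A *m expmx (t *: A))).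
Proof.
move=> lf; pose L : {scalar 'M[R]_d} := HB.pack f (GRing.isLinear.Build _ _ _ _ f lf).
have fE X : f X = \sum_i \sum_j f (delta_mx i j) * X i j.
  rewrite -[f]/(L : _ -> _) {1}[X]matrix_sum_delta linear_sum.
  apply: eq_bigr => i _; rewrite linear_sum; apply: eq_bigr => j _.
  by rewrite linearZ mulrC.
rewrite fE.
have -> : (fun t => f (expmx (t *: A))) =
   \sum_i \sum_j f (delta_mx i j) \*: (fun t => expmx (t *: A) i j).
  apply/funext => u; rewrite fE fct_sumE; apply: eq_bigr => i _.
  by rewrite fct_sumE; apply: eq_bigr.
have D i j := is_derive_expmx A t i j.
apply: is_derive_eq; apply: eq_bigr => i _; apply: eq_bigr => j _.
by [].
Qed.

Let re i j X : R := complex.Re (conj_cplx X i j).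
Let im i j X : R := complex.Im (conj_cplx X i j).

Let ReDZ (a : R) (z y : R[i]) : complex.Re (a%:C%C * z + y) = a * complex.Re z + complex.Re y.
Proof. by case: z => z1 z2; case: y => y1 y2 /=; rewrite mul0r subr0. Qed.

Let ImDZ (a : R) (z y : R[i]) : complex.Im (a%:C%C * z + y) = a * complex.Im z + complex.Im y.
Proof. by case: z => z1 z2; case: y => y1 y2 /=; rewrite mul0r addr0. Qed.

Let ReM (y z : R[i]) : complex.Re (y * z) =
  complex.Re y * complex.Re z - complex.Im y * complex.Im z.
Proof. by case: y => y1 y2; case: z. Qed.

Let ImM (y z : R[i]) : complex.Im (y * z) =
  complex.Re y * complex.Im z + complex.Im y * complex.Re z.
Proof. by case: y => y1 y2; case: z. Qed.

Let re_scalar i j : scalar (re i j).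
Proof. by move=> a X Y; rewrite /re conj_cplx_linear ReDZ. Qed.

Let im_scalar i j : scalar (im i j).
Proof. by move=> a X Y; rewrite /im conj_cplx_linear ImDZ. Qed.

Lemma conj_expmx_trig t : is_trig_mx (conj_cplx (expmx (t *: A))).
Proof.
apply/is_trig_mxP => i j ij.
have H k : conj_cplx (A ^+ k) i j = 0.
  by rewrite conj_cplxX //; have /is_trig_mxP := trigmx_exp k hT; exact.
apply/eqP; rewrite eq_complex /= -/(re i j _) -/(im i j _).
by rewrite !expmx_lin0 //= => [|k|k]; rewrite ?eqxx // /re /im H.
Qed.

(** By triangularity the diagonal entry z of the conjugated exponential solves z' = a z, with a the
    diagonal entry of the conjugated [A]. Its squared modulus [g] therefore solves the real equation
    g' = 2 Re(a) g with g(0) = 1. *)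
Lemma conj_expmx_diag t j :
  normc (conj_cplx (expmx (t *: A)) j j) = expR (t * complex.Re (conj_cplx A j j)).
Proof.
pose p := complex.Re (conj_cplx A j j).
pose g u := re j j (expmx (u *: A)) ^+ 2 + im j j (expmx (u *: A)) ^+ 2.
have gD u : is_derive u (1 : R) g (2 * p * g u).
  have D1 := is_derive_expmx_scalar u (re_scalar j j).
  have D2 := is_derive_expmx_scalar u (im_scalar j j).
  apply: is_derive_eq; rewrite /g.
  have D j' : conj_cplx (A *m expmx (u *: A)) j' j' =
     conj_cplx A j' j' * conj_cplx (expmx (u *: A)) j' j'.
    by rewrite conj_cplxM //; exact: (trigmx_mul_diag _ hT (conj_expmx_trig u)).
  rewrite /re /im /p D ReM ImM.
  generalize (conj_cplx A j j) (conj_cplx (expmx (u *: A)) j j) => z x.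
  generalize (complex.Re z) (complex.Im z) (complex.Re x) (complex.Im x) => *.
  by rewrite /GRing.scale /=; ring.
have eD u : is_derive u (1 : R) (fun u => expR (- (2 * p) * u)) (- (2 * p) * expR (- (2 * p) * u)).
  by apply: is_derive_eq; rewrite /GRing.scale /=; ring.
have gE : g t = expR (2 * p * t).
  pose h u := g u * expR (- (2 * p) * u).
  have H u : is_derive u (1 : R) h 0.
    have -> : h = g * (fun u => expR (- (2 * p) * u)) by [].
    apply: is_derive_eq; rewrite /GRing.scale /=.
    by generalize (g u) (expR (- (2 * p) * u)) => *; ring.
  have : h t = h 0 by exact: (is_derive_0_is_cst t 0 H).
  rewrite /h.
  have cE : conj_cplx (expmx (0 *: A)) j j = 1 by rewrite expmx0 conj_cplx1 // mxE eqxx.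
  have g0 : g 0 = 1 by rewrite /g /re /im cE /= expr1n expr0n addr0.
  rewrite g0; generalize (g t) => a.
  rewrite mulr0 expR0 mulr1 mulNr expRN => /(canRL (mulfVK _)) -> //.
    by rewrite mul1r.
  by rewrite gt_eqF ?expR_gt0.
rewrite /normc; move: gE; rewrite /g /re /im; case: (conj_cplx _ _ _) => x1 x2 /= ->.
have -> : expR (2 * p * t) = expR (t * p) ^+ 2.
  by rewrite -expRM_natl; congr expR; ring.
by rewrite sqrtr_sqr ger0_norm ?expR_ge0.
Qed.

End ExponentialTriangular.

(** * Trajectories *)

Section LocallyBoundedMeasurable.
Context {R : realType}.
Local Notation mu := (@lebesgue_measure R).
Implicit Types (g h : R -> R).

(** A class closed under sums, products and shifts that contains the continuous functions and is
    integrable over bounded intervals; the integrands of the trajectories and the costs of controls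
    all lie in it. *)
Definition locb g := measurable_fun [set: R] g /\
  forall T, exists M, forall s, `|s| <= T -> `|g s| <= M.

Lemma locb_continuous g : continuous g -> locb g.
Proof.
move=> cg; split; first exact: continuous_measurable_fun.
move=> T; have cT : {within `[- T, T], continuous g} by apply: continuous_subspaceT.
have [M [_ HM]] := compact_bounded (continuous_compact cT (@segment_compact _ _ _)).
exists (M + 1) => s sT; apply: (HM (M + 1)); first by rewrite ltrDl.
by exists s => //=; rewrite in_itv /= -ler_norml.
Qed.

Lemma locb_cst c : locb (fun=> c).
Proof. by apply: locb_continuous => x; exact: cvg_cst. Qed.

Lemma locbD g h : locb g -> locb h -> locb (fun s => g s + h s).
Proof.
move=> [mg bg] [mh bh]; split; first exact: measurable_funD.
move=> T; have [M HM] := bg T; have [N HN] := bh T; exists (M + N) => s sT.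
by rewrite (le_trans (ler_normD _ _)) // lerD ?HM ?HN.
Qed.

Lemma locbM g h : locb g -> locb h -> locb (fun s => g s * h s).
Proof.
move=> [mg bg] [mh bh]; split; first exact: measurable_funM.
move=> T; have [M HM] := bg T; have [N HN] := bh T; exists (M * N) => s sT.
by rewrite normrM ler_pM ?HM ?HN.
Qed.

Lemma locb_sum (I : finType) (g : I -> R -> R) : (forall i, locb (g i)) ->
  locb (fun s => \sum_i g i s).
Proof.
move=> bg; split; first by apply: measurable_sum => i; exact: (bg i).1.
move=> T; have [M HM] := choice (fun i => (bg i).2 T).
exists (\sum_i M i) => s sT; rewrite (le_trans (ler_norm_sum _ _ _)) // ler_sum // => i _.
exact: HM.
Qed.

Lemma locb_shift g t : locb g -> locb (fun s => g (t + s)).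
Proof.
move=> [mg bg]; split.
  apply: (measurableT_comp mg); exact: measurable_funD.
move=> T; have [M HM] := bg (`|t| + T); exists M => s sT; apply: HM.
by rewrite (le_trans (ler_normD _ _)) // lerD2l.
Qed.

Lemma locb_integrable g a b : locb g -> mu.-integrable `[a, b] (EFin \o g).
Proof.
move=> [mg bg]; apply: measurable_bounded_integrable => //=.
- by rewrite lebesgue_measure_itv /=; case: ifP => // _; rewrite -EFinB ltry.
- exact: measurable_funTS.
- have [M HM] := bg (Num.max `|a| `|b|).
  exists M; split; first exact: num_real.
  move=> x Mx s /=; rewrite in_itv /= => /andP[as_ sb]; apply: le_trans (ltW Mx).
  apply: HM; rewrite le_max; have [s0|s0] := leP 0 s.
    by apply/orP; right; rewrite ger0_norm // (le_trans sb) // ler_norm.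
  by apply/orP; left; rewrite ltr0_norm // -normrN (le_trans _ (ler_norm _)) // lerN2.
Qed.

Lemma Rintegral_split g a b c : locb g -> a <= b -> b <= c ->
  \int[mu]_(s in `[a, c]) g s =
  \int[mu]_(s in `[a, b]) g s + \int[mu]_(s in `[b, c]) g s.
Proof.
move=> bg ab bc.
have := @Rintegral_itvB R g (BLeft a) (BRight c) b (locb_integrable _ _ bg).
rewrite !bnd_simp => /(_ ab bc) H.
rewrite -(Rintegral_itv_obnd_cbnd (r := b)); last first.
  apply: integrableS (locb_integrable b c bg) => //.
  by apply: subset_itvr; rewrite bnd_simp.
by rewrite -H addrC subrK.
Qed.

(** The translated measure agrees with Lebesgue measure on half-open intervals, which determine
    it. *)
Lemma lebesgue_measure_shift t (X : set R) : measurable X ->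
  mu X = pushforward mu (fun s : R => t + s) X.
Proof.
have mt : measurable_fun [set: R] (fun s : R => t + s) by exact: measurable_funD.
pose nu : {measure set (measurableTypeR R) -> \bar R} :=
  HB.pack (pushforward mu (fun s : R => t + s : measurableTypeR R)).
apply: (@lebesgue_measure_unique R (nu mt)) => _ [[a b] /= ab <-].
rewrite /nu /= /pushforward.
have -> : (fun s : R => t + s) @^-1` `]a, b] = `]a - t, b - t]%classic.
  by apply/seteqP; split => s; rewrite /= !in_itv /= ltrBlDl lerBrDl.
rewrite !lebesgue_measure_itv /= !lte_fin ltrD2r; case: ifP => // _.
by rewrite -!EFinB; congr (_%:E); ring.
Qed.

Lemma Rintegral_shift g t a b : locb g ->
  \int[mu]_(s in `[t + a, t + b]) g s = \int[mu]_(s in `[a, b]) g (t + s).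
Proof.
move=> bg; rewrite /Rintegral; congr fine.
have mt : measurable_fun [set: R] (fun s : R => t + s) by exact: measurable_funD.
have preE : (fun s : R => t + s) @^-1` `[t + a, t + b] = `[a, b]%classic.
  by apply/seteqP; split => s; rewrite /= !in_itv /= !lerD2l.
rewrite (eq_measure_integral (pushforward mu (fun s : R => t + s : measurableTypeR R))); last first.
  by move=> X mX _; exact: lebesgue_measure_shift.
rewrite integral_pushforward ?preE //=.
- by apply/measurable_EFinP; exact: bg.1.
- exact: (locb_integrable a b (locb_shift t bg)).
Qed.

End LocallyBoundedMeasurable.

(** * Integrals of vector-valued functions *)

Section VectorIntegral.
Context {R : realType}.
Local Notation mu := (@lebesgue_measure R).

Definition vlocb p (w : R -> 'cV[R]_p) := forall i, locb (fun s => w s i 0).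

Definition vint p (a b : R) (g : R -> 'cV[R]_p) : 'cV[R]_p :=
  \col_i (\int[mu]_(s in `[a, b]) (g s i 0))%R.

Lemma vlocb_cst p (v : 'cV[R]_p) : vlocb (fun=> v).
Proof. by move=> i; exact: locb_cst. Qed.

Lemma vlocbZ p c (g : R -> 'cV[R]_p) : vlocb g -> vlocb (fun s => c *: g s).
Proof.
move=> bg i; have := locbM (locb_cst c) (bg i).
by under [X in _ -> locb X]eq_fun do rewrite mxE.
Qed.

Lemma vlocb_shift p t (g : R -> 'cV[R]_p) : vlocb g -> vlocb (fun s => g (t + s)).
Proof. by move=> bg i; have := locb_shift t (bg i). Qed.

Lemma vlocb_mulmx p q (M : R -> 'M[R]_(q, p)) (g : R -> 'cV[R]_p) :
  (forall i j, continuous (fun s => M s i j)) -> vlocb g ->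
  vlocb (fun s => M s *m g s).
Proof.
move=> cM bg i; under [X in locb X]eq_fun do rewrite mxE.
by apply: locb_sum => k; apply: locbM => //; exact: locb_continuous.
Qed.

Lemma eq_vint p a b (g h : R -> 'cV[R]_p) : (forall s, a <= s <= b -> g s = h s) ->
  vint a b g = vint a b h.
Proof.
move=> gh; apply/colP => i; rewrite !mxE; apply: eq_Rintegral => s.
by rewrite inE /= in_itv /= => /gh ->.
Qed.

(** The left endpoint is exempt, being a null set: at the switching time a concatenated control
    still has the value of its first part. *)
Lemma eq_vint_oc p a b (g h : R -> 'cV[R]_p) : vlocb g -> vlocb h ->
  (forall s, a < s -> s <= b -> g s = h s) -> vint a b g = vint a b h.
Proof.
move=> bg bh gh; apply/colP => i; rewrite !mxE.
have sub : (`]a, b]%classic : set R) `<=` `[a, b]%classic by apply: subset_itvr; rewrite bnd_simp.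
rewrite -Rintegral_itv_obnd_cbnd; last first.
  by apply: integrableS (locb_integrable a b (bg i)).
rewrite -Rintegral_itv_obnd_cbnd; last first.
  by apply: integrableS (locb_integrable a b (bh i)).
apply: eq_Rintegral => s.
by rewrite inE /= in_itv /= => /andP[sa sb]; rewrite gh.
Qed.

Lemma vintD p a b (g h : R -> 'cV[R]_p) : vlocb g -> vlocb h ->
  vint a b (fun s => g s + h s) = vint a b g + vint a b h.
Proof.
move=> bg bh; apply/colP => i; rewrite !mxE -RintegralD //.
- by apply: eq_Rintegral => s _; rewrite mxE.
- exact: locb_integrable.
- exact: locb_integrable.
Qed.

Lemma mulmx_vint p q a b (M : 'M[R]_(q, p)) (g : R -> 'cV[R]_p) : vlocb g ->
  M *m vint a b g = vint a b (fun s => M *m g s).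
Proof.
move=> bg; apply/colP => i; rewrite !mxE.
under eq_bigr do rewrite mxE.
under [RHS]eq_Rintegral do rewrite mxE.
(* Induction over the index list; local boundedness is carried along because additivity of the
   integral needs integrable partial sums. *)
have H (r : seq 'I_p) : \sum_(j <- r) M i j * \int[mu]_(s in `[a, b]) g s j 0 =
   \int[mu]_(s in `[a, b]) (\sum_(j <- r) M i j * g s j 0)%R /\
   locb (fun s => \sum_(j <- r) M i j * g s j 0).
  elim: r => [|j r [IH1 IH2]].
    split.
      by rewrite big_nil; under eq_Rintegral do rewrite big_nil; rewrite Rintegral_cst // mul0r.
    by under [X in locb X]eq_fun do rewrite big_nil; exact: locb_cst.
  have bj := locbM (locb_cst (M i j)) (bg j).
  split; last by under [X in locb X]eq_fun do rewrite big_cons; exact: locbD.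
  rewrite big_cons IH1; under [RHS]eq_Rintegral do rewrite big_cons.
  rewrite RintegralD //; [|exact: locb_integrable|exact: locb_integrable].
  congr (_ + _); rewrite RintegralZl //; exact: locb_integrable.
exact: (H _).1.
Qed.

Lemma vintZ p a b c (g : R -> 'cV[R]_p) : vlocb g ->
  vint a b (fun s => c *: g s) = c *: vint a b g.
Proof.
move=> bg; rewrite -[RHS]mul_scalar_mx mulmx_vint //.
by apply: eq_vint => s _; rewrite mul_scalar_mx.
Qed.

Lemma vint_split p a b c (g : R -> 'cV[R]_p) : vlocb g -> a <= b -> b <= c ->
  vint a c g = vint a b g + vint b c g.
Proof.
by move=> bg ab bc; apply/colP => i; rewrite !mxE (@Rintegral_split _ _ a b c).
Qed.

Lemma vint_shift p t b (g : R -> 'cV[R]_p) : vlocb g ->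
  vint t (t + b) g = vint 0 b (fun s => g (t + s)).
Proof.
move=> bg; apply/colP => i; rewrite !mxE -[X in `[X, _]]addr0.
exact: (Rintegral_shift t 0 b (bg i)).
Qed.

Lemma vint_norm p a b M (g : R -> 'cV[R]_p) : vlocb g -> a <= b -> 0 <= M ->
  (forall s, a <= s <= b -> `|g s| <= M) -> `|vint a b g| <= M * (b - a).
Proof.
move=> bg ab M0 gM; apply: mx_norm_le => [|i j].
  by rewrite mulr_ge0 // subr_ge0.
rewrite ord1 mxE; apply: le_trans (le_normr_Rintegral _ _) _ => //.
  exact: locb_integrable.
have -> : M * (b - a) = \int[mu]_(s in `[a, b]) M.
  rewrite Rintegral_cst //= lebesgue_measure_itv /= lte_fin.
  by case: ltgtP ab => // -> _; rewrite subrr.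
apply: le_Rintegral => //.
- have bi : locb (fun s => `|g s i 0|).
    split; first by apply: measurableT_comp => //; exact: (bg i).1.
    by move=> T; have [N HN] := (bg i).2 T; exists N => s sT; rewrite normr_id HN.
  exact: locb_integrable.
- exact: (locb_integrable _ _ (locb_cst M)).
- move=> s /=; rewrite in_itv /= => sab; apply: le_trans (gM s sab).
  exact: mx_norm_entry.
Qed.

End VectorIntegral.

(** * The variation-of-constants formula *)

Section Trajectory.
Context {R : realType} {d m : nat}.
Variables (A : 'M[R]_d) (B : 'M[R]_(d, m)).
Implicit Types (x y : 'cV[R]_d) (w v : R -> 'cV[R]_m) (t s : R).

Lemma trajectoryE t x w : trajectory A B t x w =
  expmx (t *: A) *m x + vint 0 t (fun s => expmx ((t - s) *: A) *m B *m w s).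
Proof. by []. Qed.

Lemma continuous_expmx_mul t i j : continuous (fun s => (expmx ((t - s) *: A) *m B) i j).
Proof.
move=> s; rewrite /continuous_at mxE.
under eq_fun do rewrite mxE.
apply: cvg_sumr => k; apply: cvgMr_tmp.
apply: (@continuous_comp _ _ _ (fun s => t - s) (fun u => expmx (u *: A) i k)).
  by apply: cvgB; [exact: cvg_cst|exact: cvg_id].
exact: continuous_expmx.
Qed.

Lemma vlocb_kernel t w : vlocb w -> vlocb (fun s => expmx ((t - s) *: A) *m B *m w s).
Proof. by move=> bw; apply: vlocb_mulmx => // i j; exact: continuous_expmx_mul. Qed.

Lemma trajectoryD t x y w v : vlocb w -> vlocb v ->
  trajectory A B t (x + y) (fun s => w s + v s) =
  trajectory A B t x w + trajectory A B t y v.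
Proof.
move=> bw bv; rewrite !trajectoryE mulmxDr.
rewrite (@eq_vint _ _ _ _ _ (fun s => expmx ((t - s) *: A) *m B *m w s +
  expmx ((t - s) *: A) *m B *m v s)); last by move=> s _; rewrite mulmxDr.
by rewrite vintD; [rewrite addrACA|exact: vlocb_kernel|exact: vlocb_kernel].
Qed.

Lemma trajectoryZ c t x w : vlocb w ->
  trajectory A B t (c *: x) (fun s => c *: w s) = c *: trajectory A B t x w.
Proof.
move=> bw; rewrite !trajectoryE scalerDr scalemxAr; congr (_ + _).
rewrite -vintZ; last exact: vlocb_kernel.
by apply: eq_vint => s _; rewrite scalemxAr.
Qed.

Lemma trajectory_sub t x y w :
  trajectory A B t x w - trajectory A B t y w = expmx (t *: A) *m (x - y).
Proof. by rewrite !trajectoryE opprD addrACA subrr addr0 mulmxBr. Qed.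

Lemma eq_trajectory t x w v : vlocb w -> vlocb v ->
  (forall s, 0 < s -> s <= t -> w s = v s) ->
  trajectory A B t x w = trajectory A B t x v.
Proof.
move=> bw bv wv; rewrite !trajectoryE; congr (_ + _).
by apply: eq_vint_oc => [||s s0 st]; [exact: vlocb_kernel|exact: vlocb_kernel|rewrite wv].
Qed.

Lemma trajectory0 x w : trajectory A B 0 x w = x.
Proof.
rewrite trajectoryE expmx0 mul1mx; apply/colP => i.
by rewrite !mxE set_itv1 Rintegral_set1 addr0.
Qed.

Lemma trajectory_cocycle t s x w : vlocb w -> 0 <= t -> 0 <= s ->
  trajectory A B (t + s) x w =
  trajectory A B s (trajectory A B t x w) (fun r => w (t + r)).
Proof.
move=> bw t0 s0; rewrite !trajectoryE mulmxDr mulmxA -expmxD (addrC s t) -addrA.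
congr (_ + _).
have bk := vlocb_kernel (t + s) bw; have bk' := vlocb_kernel t bw.
have lts : t <= t + s by rewrite lerDl.
rewrite (vint_split bk t0 lts) (mulmx_vint 0 t _ bk'); congr (_ + _).
  apply: eq_vint => r _.
  have -> : t + s - r = s + (t - r) by ring.
  by rewrite expmxD !mulmxA.
rewrite (vint_shift t s bk); apply: eq_vint => r _.
by have -> : t + s - (t + r) = s - r by ring.
Qed.

(** One constant serves all times up to [b], and by homogeneity in [c] also initial states of any
    size. *)
Lemma trajectory_bound b M : 0 <= b -> 0 <= M -> exists C, 0 <= C /\
  forall t c x w, 0 <= t <= b -> 0 <= c -> vlocb w ->
    (forall s, 0 <= s <= t -> `|w s| <= M * c) -> `|x| <= c ->
    `|trajectory A B t x w| <= C * c.
Proof.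
move=> b0 M0; pose e := expR (d%:R * `|A| * b).
have e0 : 0 <= e by exact: expR_ge0.
have eE t : `|t| <= b -> `|expmx (t *: A)| <= e.
  move=> tb; apply: (le_trans (expmx_norm _ _)); rewrite ler_expR.
  by apply: ler_wpM2l => //; exact: mulr_ge0.
exists (d%:R * e + m%:R * (d%:R * e * `|B|) * M * b); split.
  by apply: addr_ge0; repeat apply: mulr_ge0.
move=> t c x w /andP[t0 tb] c0 bw wM xc; rewrite trajectoryE mulrDl.
apply: (le_trans (ler_normD _ _)); apply: lerD.
  apply: (le_trans (mx_norm_mul _ _)); rewrite ler_pM ?mulr_ge0 //.
  by rewrite ler_wpM2l // eE // ger0_norm.
have -> : m%:R * (d%:R * e * `|B|) * M * b * c = m%:R * (d%:R * e * `|B|) * (M * c) * b by ring.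
apply: (@le_trans _ _ (m%:R * (d%:R * e * `|B|) * (M * c) * (t - 0))).
  apply: vint_norm => //; first exact: vlocb_kernel.
    by rewrite !mulr_ge0.
  move=> s /andP[s0 st]; apply: (le_trans (mx_norm_mul _ _)).
  rewrite ler_pM ?mulr_ge0 //; last by rewrite wM // s0.
  rewrite ler_wpM2l //; apply: (le_trans (mx_norm_mul _ _)).
  rewrite ler_wpM2r // ler_wpM2l // eE //.
  by rewrite ger0_norm ?subr_ge0 // lerBlDr (le_trans tb) // lerDl.
by rewrite subr0 ler_wpM2l // !mulr_ge0.
Qed.

(** Since [B *m u] equals [- (A *m x)], the integrand is the derivative of s -> exp((t-s)A) x, and
    the integral is [x] minus exp(tA) x. *)
Lemma trajectory_equilibrium t x (u : 'cV[R]_m) : 0 <= t -> A *m x + B *m u = 0 ->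
  trajectory A B t x (fun=> u) = x.
Proof.
rewrite le_eqVlt => /predU1P[<- _|t0 xu]; first exact: trajectory0.
have Bu : B *m u = - (A *m x) by apply/eqP; rewrite -addr_eq0 addrC xu.
rewrite trajectoryE; apply/colP => i; rewrite !mxE.
pose F s := (expmx ((t - s) *: A) *m x) i 0.
pose f s := (expmx ((t - s) *: A) *m B *m u) i 0.
have dF s : is_derive s (1 : R) F (f s).
  have -> : F = \sum_(k < d) x k 0 \*: (fun s => expmx ((t - s) *: A) i k).
    apply/funext => r; rewrite /F mxE fct_sumE; apply: eq_bigr => k _.
    by rewrite /GRing.scale /= mulrC.
  have D k : is_derive s (1 : R) (fun s => expmx ((t - s) *: A) i k)
     (- (A *m expmx ((t - s) *: A)) i k).
    rewrite -[X in is_derive _ _ _ X]mulN1r.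
    apply: (@is_derive_expmx_comp _ _ A (fun s => t - s)).
    have := @is_deriveB _ _ _ (cst t) id s 1 0 1 (is_derive_cst _ _ _) (is_derive_id _ _).
    by rewrite sub0r.
  apply: is_derive_eq; rewrite /f -mulmxA Bu mulmxN mulmxA -expmx_comm mxE mulmx_entry -sumrN.
  by apply: eq_bigr => k _; rewrite /GRing.scale /=; ring.
have cf : continuous f.
  move=> s; rewrite /continuous_at /f mulmx_entry.
  under eq_fun do rewrite mulmx_entry.
  by apply: cvg_sumr => k; apply: cvgMr_tmp; exact: continuous_expmx_mul.
have H : (\int[@lebesgue_measure R]_(s in `[0%R, t]) (f s)%:E = (F t)%:E - (F 0%R)%:E)%E.
  apply: continuous_FTC2 => //.
  - by apply: continuous_subspaceT.
  - have cF : continuous F.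
      move=> s; apply: differentiable_continuous; apply/derivable1_diffP.
      by have [] := dF s.
    split.
    + by move=> s _; have [] := dF s.
    + by apply: cvg_at_right_filter; exact: cF.
    + by apply: cvg_at_left_filter; exact: cF.
  - by move=> s _; rewrite derive1E; have [_ ->] := dF s.
transitivity (F 0 + Rintegral (@lebesgue_measure R) `[0, t] f).
  by rewrite /F subr0 mulmx_entry.
by rewrite /Rintegral H -EFinB /= addrC subrK /F subrr expmx0 mul1mx.
Qed.

End Trajectory.

(** * Controls and reachability *)

Section Controls.
Context {R : realType} {m : nat}.
Implicit Types (U : set 'cV[R]_m) (w v : R -> 'cV[R]_m).

Definition borel_control w := measurable_fun [set: R]
  (w : R -> g_sigma_algebraType (@open 'cV[R]_m)).

(** Stated through preimages under [f \o w] instead of continuity of [f], because the potential is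
    continuous only relative to [U], where the control takes its values. *)
Lemma borel_control_comp w (f : 'cV[R]_m -> R) : borel_control w ->
  (forall O : set R, open O -> exists2 V, open V & (f \o w) @^-1` O = w @^-1` V) ->
  measurable_fun [set: R] (f \o w).
Proof.
move=> mw fw; apply: (measurability _ (RGenOpens.measurableE R)).
move=> _ [_ [a [b ->] <-]]; rewrite setTI.
have [|V oV ->] := fw `]a, b[%classic; first exact: interval_open.
rewrite -[X in measurable X]setTI; apply: mw => //.
exact: sub_sigma_algebra.
Qed.

Lemma controls_vlocb U w : compact U -> controls U w -> vlocb w.
Proof.
move=> cU [mw wU] i; split.
  apply: (@borel_control_comp w (fun x => x i 0)) => // O oO.
  exists ((fun x : 'cV[R]_m => x i 0) @^-1` O) => //.
  by apply: open_comp => // x _; exact: coord_continuous.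
have [M [_ HM]] := compact_bounded cU.
move=> T; exists (M + 1) => s _; apply: (le_trans (mx_norm_entry _ _ _)).
by apply: (HM (M + 1)) => //; rewrite ltrDl.
Qed.

Lemma borel_controlP w :
  (forall O : set 'cV[R]_m, open O -> measurable (w @^-1` O)) -> borel_control w.
Proof.
move=> mw.
apply: (@measurability _ _ _ (g_sigma_algebraType (@open 'cV[R]_m)) _ _ _ erefl).
by move=> _ [V oV <-]; rewrite setTI; exact: mw.
Qed.

Lemma controls_cst U u : U u -> controls U (fun=> u).
Proof. by move=> Uu; split => //; exact: measurable_cst. Qed.

Lemma controls_shift U w t : controls U w -> controls U (fun s => w (t + s)).
Proof.
move=> [mw wU]; split => //.
apply: (measurableT_comp mw); exact: measurable_funD.
Qed.

Definition concat (T : R) w v : R -> 'cV[R]_m :=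
  fun s => if s <= T then w s else v (s - T).

Lemma controls_concat U T w v : controls U w -> controls U v -> controls U (concat T w v).
Proof.
move=> [mw wU] [mv vU]; split; last by move=> t; rewrite /concat; case: ifP.
apply: measurable_fun_ifT => //.
- exact: measurable_fun_ler.
- by apply: (measurableT_comp mv); exact: measurable_funB.
Qed.

(** A continuous steering control may leave [U] outside [[0, T]]; the constant value [u0] replaces
    it there. *)
Lemma continuous_controls U w u0 T : continuous w -> U u0 ->
  (forall s, 0 <= s <= T -> U (w s)) ->
  controls U (fun s => if (0 <= s) && (s <= T) then w s else u0).
Proof.
move=> cw Uu0 wU; split; last by move=> s; case: ifP => // /wU.
apply: measurable_fun_ifT => //.
- by apply: measurable_and; exact: measurable_fun_ler.
- apply: borel_controlP => O oO; apply: open_measurable.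
  by apply: open_comp => // x _; exact: cw.
Qed.

End Controls.

Section Concatenation.
Context {R : realType} {d m : nat}.
Variables (A : 'M[R]_d) (B : 'M[R]_(d, m)).
Implicit Types (x y : 'cV[R]_d) (w v : R -> 'cV[R]_m) (t s : R).

Lemma vlocb_concat T w v : vlocb w -> vlocb v -> vlocb (concat T w v).
Proof.
move=> bw bv i; rewrite /concat.
have -> : (fun s => (if s <= T then w s else v (s - T)) i 0) =
  (fun s => if s <= T then w s i 0 else v (s - T) i 0).
  by apply/funext => s; case: ifP.
have [mw Bw] := bw i; have [mv Bv] := bv i.
split.
  apply: measurable_fun_ifT => //; first exact: measurable_fun_ler.
  by apply: (measurableT_comp mv); exact: measurable_funB.
move=> S; have [M HM] := Bw S; have [N HN] := Bv (S + `|T|).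
exists (Num.max M N) => s sS; rewrite le_max; case: ifP => _; first by rewrite HM.
by rewrite HN ?orbT // (le_trans (ler_normB _ _)) // lerD2r.
Qed.

Lemma trajectory_concat_le T t x w v : vlocb w -> vlocb v -> t <= T ->
  trajectory A B t x (concat T w v) = trajectory A B t x w.
Proof.
move=> bw bv tT; apply: eq_trajectory => //; first exact: vlocb_concat.
by move=> s _ st; rewrite /concat (le_trans st tT).
Qed.

Lemma trajectory_concat_ge T s x w v : vlocb w -> vlocb v -> 0 <= T -> 0 <= s ->
  trajectory A B (T + s) x (concat T w v) =
  trajectory A B s (trajectory A B T x w) v.
Proof.
move=> bw bv T0 s0; have bc := vlocb_concat T bw bv.
rewrite trajectory_cocycle // trajectory_concat_le //.
apply: eq_trajectory => //; first exact: vlocb_shift.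
by move=> r r0 _; rewrite /concat gerDl leNgt r0 /= addrC addKr.
Qed.

End Concatenation.

(** * Steering by means of the controllability Gramian *)

Section Reachability.
Context {R : realType} {d m : nat}.
Variables (A : 'M[R]_d) (B : 'M[R]_(d, m)).
Local Notation mu := (@lebesgue_measure R).

(** If [q s] were positive, [q] would be at least [q s / 2] on an interval of positive length around
    [s] inside [[0, T]], and the integral would be positive. *)
Lemma Rintegral_continuous_eq0 (q : R -> R) (T : R) : continuous q ->
  (forall s, 0 <= q s) -> \int[mu]_(s in `[0, T]) q s = 0 ->
  forall s, 0 < s -> s < T -> q s = 0.
Proof.
move=> cq q0 iq s s0 sT; apply/eqP; apply: contraT => qs.
have {qs} qs : 0 < q s by rewrite lt_neqAle eq_sym qs q0.
have h0 : 0 < q s / 2 by rewrite divr_gt0.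
have bq : locb q by exact: locb_continuous.
have /cvgrPdist_lt /(_ _ h0) /nbhs_ballP [e /= e0 He] := cq s.
pose b := Num.min (e / 2) (Num.min s (T - s)).
have b0 : 0 < b by rewrite !lt_min divr_gt0 //= s0 subr_gt0.
have be : b <= e / 2 by rewrite /b ge_min lexx.
have bs : b <= s by rewrite /b !ge_min lexx orbT.
have bT : b <= T - s by rewrite /b !ge_min lexx !orbT.
have a0 : 0 <= s - b by rewrite subr_ge0.
have cT : s + b <= T by rewrite -lerBrDl.
have ac : s - b < s + b by rewrite ltrBlDr -addrA ltrDl addr_gt0.
suff : 0 < \int[mu]_(r in `[0, T]) q r by rewrite iq ltxx.
rewrite (@Rintegral_split _ q 0 (s - b) T bq a0 (le_trans (ltW ac) cT)).
rewrite (@Rintegral_split _ q (s - b) (s + b) T bq (ltW ac) cT).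
apply: ltr_wpDl; first exact: Rintegral_ge0.
apply: ltr_wpDr; first exact: Rintegral_ge0.
apply: (@lt_le_trans _ _ (\int[mu]_(r in `[s - b, s + b]) (q s / 2))).
  rewrite Rintegral_cst //= lebesgue_measure_itv /= lte_fin ac.
  by rewrite -EFinB /= mulr_gt0 // subr_gt0.
apply: le_Rintegral => //.
- exact: (locb_integrable _ _ (locb_cst _)).
- exact: locb_integrable.
- move=> r /=; rewrite in_itv /= => /andP[r1 r2].
  have : `|q s - q r| < q s / 2.
    apply: He; rewrite /ball /= (@le_lt_trans _ _ b) //.
      rewrite ler_norml lerBrDr lerBlDr addrC.
      by rewrite -lerBrDr opprK addrC in r2 *; rewrite ?r2 // -lerBlDl r1 //.
    by rewrite (le_lt_trans be) // ltr_pdivrMr // mulr_natr mulr2n ltrDl.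
  rewrite ltr_norml => /andP[_]; rewrite ltrBlDr -ltrBlDl => /ltW.
  by rewrite {1}(splitr (q s)) addrK.
Qed.

(** Differentiating p exp(uA) C = 0 in [u] gives p exp(uA) A C = 0 on the same open interval; the
    induction on [k] replaces [C] by [A *m C]. *)
Lemma expmx_annihilate p (C : 'M[R]_(d, m)) T : 0 < T ->
  (forall u, 0 < u -> u < T -> p *m expmx (u *: A) *m C = 0 :> 'rV[R]_m) ->
  forall k u, 0 < u -> u < T -> p *m expmx (u *: A) *m (A ^+ k *m C) = 0.
Proof.
move=> T0 + k; elim: k C => [|k IH] C HC u u0 uT.
  by rewrite expr0 mul1mx HC.
have -> : A ^+ k.+1 *m C = A ^+ k *m (A *m C).
  by rewrite -addn1 exprmxD expr1 mulmxA.
apply: IH => // {u0 uT}u u0 uT; apply/rowP => j; rewrite [RHS]mxE.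
pose g u := (p *m expmx (u *: A) *m C) 0 j.
have D : is_derive u (1 : R) g ((p *m expmx (u *: A) *m (A *m C)) 0 j).
  have -> : g = \sum_(k < d) \sum_(l < d) (p 0 k * C l j) \*: (fun u => expmx (u *: A) k l).
    apply/funext => r; rewrite /g -mulmxA mulmx_entry fct_sumE; apply: eq_bigr => a _.
    rewrite mulmx_entry mulr_sumr fct_sumE; apply: eq_bigr => b _.
    by transitivity ((p 0 a * C b j) * expmx (r *: A) a b); first ring.
  have H k' l := is_derive_expmx A u k' l.
  apply: is_derive_eq.
  have -> : p *m expmx (u *: A) *m (A *m C) = p *m ((A *m expmx (u *: A)) *m C).
    by rewrite expmx_comm !mulmxA.
  rewrite mulmx_entry; apply: eq_bigr => a _.
  rewrite mulmx_entry mulr_sumr; apply: eq_bigr => b _.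
  by transitivity ((p 0 a * C b j) * (A *m expmx (u *: A)) a b); last ring.
have D0 : is_derive u (1 : R) g 0.
  apply: (@near_eq_is_derive _ _ _ (cst 0) g) => //.
    near=> r; rewrite /g /cst HC ?mxE //; near: r; last exact: lt_nbhsl.
    exact: lt_nbhsr.
have [_ <-] := D; have [_ ->] := D0.
by [].
Unshelve. all: by end_near. Qed.

Lemma controllable_annihilate p : controllable A B ->
  (forall k, (p : 'rV[R]_d) *m (A ^+ k *m B) = 0) -> p = 0.
Proof.
move=> cAB pAB; apply/eqP.
have /mulmx_free_eq0 <- : row_free (\mxrow_(k < d) (A ^+ k *m B)).
  by rewrite /row_free; apply/eqP; exact: cAB.
rewrite mul_mxrow; apply/eqP; rewrite -[RHS]mxrow0.
by apply: eq_mxrow => k.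
Qed.

(** [W] is the controllability Gramian. For a row [p] in its left kernel, p W p^T is the integral of
    the squared length of [p *m K s] and vanishes, so p exp(uA) B = 0 for 0 < u < T, and the rank
    condition forces p = 0. With [W] invertible, the transpose of [K s] applied to [invmx W *m z] is
    a control that steers to [z]. *)
Lemma reachable (T : R) (z : 'cV[R]_d) : controllable A B -> 0 < T ->
  exists2 v : R -> 'cV[R]_m, continuous v & trajectory A B T 0 v = z.
Proof.
move=> cAB T0; pose K s := expmx ((T - s) *: A) *m B.
pose W : 'M[R]_d := \matrix_(i, j) \int[mu]_(s in `[0, T]) (K s *m (K s)^T) i j.
have cK i j : continuous (fun s => K s i j) by exact: continuous_expmx_mul.
have trK s k j : (K s)^T k j = K s j k by rewrite [LHS]mxE.
have cKK i j : continuous (fun s => (K s *m (K s)^T) i j).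
  move=> s; rewrite /continuous_at mulmx_entry.
  under eq_fun do rewrite mulmx_entry.
  apply: cvg_sumr => k; rewrite trK; under eq_fun do rewrite trK.
  by apply: cvgM; exact: cK.
have WE eta : vint 0 T (fun s => K s *m ((K s)^T *m eta)) = W *m eta.
  apply/colP => i.
  pose g s : 'cV[R]_d := \col_j (K s *m (K s)^T) i j.
  have bg : vlocb g.
    by move=> j; under [X in locb X]eq_fun do rewrite mxE; exact: locb_continuous.
  have := mulmx_vint 0 T eta^T bg => /matrixP /(_ 0 0).
  rewrite !mxE => H; transitivity (\sum_j eta^T 0 j * (vint 0 T g) j 0).
    rewrite H; apply: eq_Rintegral => s _.
    rewrite mulmxA !mulmx_entry; apply: eq_bigr => j _.
    by rewrite [g s j 0]mxE [eta^T _ _]mxE mulrC.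
  apply: eq_bigr => j _; rewrite mulrC !mxE; congr (_ * _).
  by apply: eq_Rintegral => s _; rewrite mxE.
have Wu : W \in unitmx.
  rewrite unitmxE unitfE; apply/negP => /det0P [p p0 pW].
  have pK s : 0 < s -> s < T -> p *m K s = 0.
    move=> s0 sT.
    pose q s := (p *m K s *m (p *m K s)^T) 0 0.
    have qE r : q r = \sum_k ((p *m K r) 0 k) ^+ 2.
      by rewrite /q mulmx_entry; apply: eq_bigr => k _; rewrite [_^T _ _]mxE expr2.
    have cq : continuous q.
      have -> : q = (fun r => \sum_k ((p *m K r) 0 k) ^+ 2) by exact/funext.
      move=> r; apply: cvg_sumr => k.
      have cp : (p *m K r') 0 k @[r' --> r] --> (p *m K r) 0 k.
        rewrite mulmx_entry; under eq_fun do rewrite mulmx_entry.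
        by apply: cvg_sumr => l; apply: cvgMl_tmp; exact: cK.
      by apply: cvgM.
    have iq : \int[mu]_(s in `[0, T]) q s = 0.
      have := WE p^T; rewrite -[W *m _]trmxK trmx_mul trmxK.
      have bg : vlocb (fun s => K s *m ((K s)^T *m p^T)).
        by move=> i;
        under [X in locb X]eq_fun do rewrite mulmxA;
        apply: (@vlocb_mulmx _ _ _ (fun s => K s *m (K s)^T) (fun=> p^T) cKK (vlocb_cst _)).
      move=> /(congr1 (fun x => (p *m x) 0 0)); rewrite mulmx_vint //.
      have -> : p *m (p *m W^T)^T = 0 by rewrite trmx_mul trmxK mulmxA pW mul0mx.
      rewrite !mxE => H; rewrite -[RHS]H; apply: eq_Rintegral => r _.
      by rewrite /q trmx_mul !mulmxA.
    have := Rintegral_continuous_eq0 cq _ iq s0 sT.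
    rewrite qE => q0; apply/rowP => k; rewrite [RHS]mxE; apply/eqP; rewrite -sqrf_eq0.
    have : \sum_k ((p *m K s) 0 k) ^+ 2 == 0.
      by apply/eqP/q0 => r; rewrite qE sumr_ge0 // => l _; exact: sqr_ge0.
    rewrite psumr_eq0; last by move=> l _; exact: sqr_ge0.
    by move=> /allP /(_ k); rewrite mem_index_enum => /(_ isT).
  have pE u : 0 < u -> u < T -> p *m expmx (u *: A) *m B = 0.
    move=> u0 uT; rewrite -mulmxA; have := pK (T - u).
    by rewrite /K subKr => -> //; lra.
  have h0 : 0 < T / 2 by lra.
  have hT : T / 2 < T by lra.
  (* [T / 2] is just an interior time: the rank condition kills the row p exp(uA) there, and the
     exponential is invertible. *)
  have q0 : p *m expmx (T / 2 *: A) = 0.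
    apply: controllable_annihilate => // k.
    exact: expmx_annihilate pE k _ h0 hT.
  move: p0; rewrite -[p]mulmx1 -(expmxKV A (T / 2)) mulmxA q0 mul0mx.
  by rewrite eqxx.
exists (fun s => (K s)^T *m (invmx W *m z)).
  move=> s; apply: cvg_mx_entry => i j; rewrite mulmx_entry.
  under eq_fun do rewrite mulmx_entry.
  apply: cvg_sumr => k; apply: cvgMr_tmp; rewrite trK.
  by under eq_fun do rewrite trK; exact: cK.
by rewrite trajectoryE mulmx0 add0r WE mulKVmx.
Qed.

End Reachability.

(** * Covering and separation in complex coordinates *)

Section ComplexVectors.
Context {R : realType}.
Local Notation C := R[i].

Lemma normc_ge0 (z : C) : 0 <= normc z.
Proof. by case: z => a b; exact: sqrtr_ge0. Qed.

Lemma normc_real (x : R) : normc (x%:C)%C = `|x|.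
Proof. by rewrite /normc /= expr0n addr0 sqrtr_sqr. Qed.

Lemma normc_Re (z : C) : `|complex.Re z| <= normc z.
Proof. by case: z => a b /=; rewrite -sqrtr_sqr ler_wsqrtr // lerDl sqr_ge0. Qed.

Lemma normc_Im (z : C) : `|complex.Im z| <= normc z.
Proof. by case: z => a b /=; rewrite -sqrtr_sqr ler_wsqrtr // lerDr sqr_ge0. Qed.

Lemma normc_ReIm (z : C) : normc z <= `|complex.Re z| + `|complex.Im z|.
Proof.
case: z => a b /=; rewrite -[leRHS]ger0_norm ?addr_ge0 // -sqrtr_sqr ler_wsqrtr //.
rewrite sqrrD !real_normK ?num_real // -addrA lerD2l addrC lerDl.
by rewrite mulrn_wge0 // mulr_ge0.
Qed.

Lemma normc_sum (I : finType) (Q : pred I) (F : I -> C) :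
  normc (\sum_(i | Q i) F i) <= \sum_(i | Q i) normc (F i).
Proof.
elim/big_rec2: _ => [|i y x _ IH]; first by rewrite normc0.
by rewrite (le_trans (le_normcD _ _)) // lerD2l.
Qed.

Definition cbox p (r : R) (z : 'cV[C]_p) := forall j, normc (z j 0) <= r.

Definition cvec p (x : 'cV[R]_p) : 'cV[C]_p := map_mx (real_complex R) x.

Lemma cboxD p r s (y z : 'cV[C]_p) : cbox r y -> cbox s z -> cbox (r + s) (y + z).
Proof.
by move=> yr zs j; rewrite mxE (le_trans (le_normcD _ _)) // lerD.
Qed.

Lemma cboxB p r s (y z : 'cV[C]_p) : cbox r y -> cbox s z -> cbox (r + s) (y - z).
Proof.
by move=> yr zs j; rewrite !mxE (le_trans (le_normcD _ _)) // normcN lerD.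
Qed.

Lemma cboxW p r s (y : 'cV[C]_p) : r <= s -> cbox r y -> cbox s y.
Proof. by move=> rs yr j; exact: le_trans rs. Qed.

Lemma cboxZ p r (a : C) (y : 'cV[C]_p) : cbox r y -> cbox (normc a * r) (a *: y).
Proof. by move=> yr j; rewrite mxE normcM ler_wpM2l // normc_ge0. Qed.

Lemma cbox_mulmx p q (M : 'M[C]_(p, q)) : exists2 c, 0 <= c &
  forall r z, 0 <= r -> cbox r z -> cbox (c * r) (M *m z).
Proof.
exists (\sum_i \sum_j normc (M i j)).
  by rewrite sumr_ge0 // => i _; rewrite sumr_ge0 // => j _; exact: normc_ge0.
move=> r z r0 zr i; rewrite mxE (le_trans (normc_sum _ _)) //.
rewrite (bigD1 i) //= mulrDl; apply: (@le_trans _ _ ((\sum_j normc (M i j)) * r)).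
  by rewrite mulr_suml ler_sum // => j _; rewrite normcM ler_wpM2l // normc_ge0.
rewrite lerDl mulr_ge0 // sumr_ge0 // => k _; rewrite sumr_ge0 // => j _; exact: normc_ge0.
Qed.

Lemma cbox_cvec p (x : 'cV[R]_p) : cbox `|x| (cvec x).
Proof. by move=> j; rewrite mxE normc_real mx_norm_entry. Qed.

Lemma cvec_le p r (x y : 'cV[R]_p) : 0 <= r -> cbox r (cvec x + 'i%C *: cvec y) ->
  `|x| <= r /\ `|y| <= r.
Proof.
move=> r0 xy; split; apply: mx_norm_le => // i j; rewrite ord1.
  apply: le_trans (xy i); apply: le_trans (normc_Re _).
  by rewrite !mxE /= mul0r mul1r sub0r oppr0 addr0.
apply: le_trans (xy i); apply: le_trans (normc_Im _).
by rewrite !mxE /= mul0r mul1r add0r add0r.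
Qed.

Lemma cvecB p (x y : 'cV[R]_p) : cvec (x - y) = cvec x - cvec y.
Proof. exact: map_mxB. Qed.

Lemma cvec_mulmx p (M : 'M[R]_p) (x : 'cV[R]_p) : cvec (M *m x) = complexify M *m cvec x.
Proof. exact: map_mxM. Qed.

Lemma cvec_split p (z : 'cV[C]_p) : exists x y, z = cvec x + 'i%C *: cvec y.
Proof.
exists (\col_j complex.Re (z j 0)), (\col_j complex.Im (z j 0)).
apply/colP => j; rewrite !mxE; case: (z j 0) => a b /=.
by apply/eqP; rewrite eq_complex /= !mul0r !mul1r subr0 !addr0 !add0r !eqxx.
Qed.

Section Grid.
Variable d : nat.
Variable n : 'I_d -> nat.

(** A grid point is an index function with one pair of steps, real and imaginary, per coordinate.
    All coordinates share the range [grid_bound], which [grid_pred] cuts down to [n j]; this avoids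
    a dependent function type. *)
Definition grid_bound := (\max_j n j).+1.
Definition grid_pred (j : 'I_d) : pred ('I_grid_bound * 'I_grid_bound) :=
  [pred p : 'I_grid_bound * 'I_grid_bound | (p.1 < n j)%N && (p.2 < n j)%N].
Definition grid := family grid_pred.

Lemma card_grid : #|grid| = (\prod_j n j ^ 2)%N.
Proof.
rewrite card_family foldrE big_map big_enum /=; apply: eq_bigr => j _.
have nb : (n j <= grid_bound)%N by rewrite leqW // leq_bigmax.
have -> : #|grid_pred j| = #|[pred p : 'I_grid_bound * 'I_grid_bound |
    (p.1 \in [pred a : 'I_grid_bound | (a < n j)%N]) &&
    (p.2 \in [pred a : 'I_grid_bound | (a < n j)%N])]|.
  by apply: eq_card => p; rewrite !inE.
rewrite cardX; have -> : #|[pred a : 'I_grid_bound | (a < n j)%N]| = n j; last by rewrite mulnn.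
rewrite -sum1_card (big_ord_narrow nb) /= sum1_card card_ord //.
Qed.

End Grid.

(** Take the first nonzero coordinate of [z]: in its row a lower triangular matrix meets, besides
    the diagonal, only earlier coordinates, which vanish. *)
Lemma trig_separated d (M : 'M[C]_d) (z : 'cV[C]_d) : is_trig_mx M -> z != 0 ->
  exists2 j, z j 0 != 0 & (M *m z) j 0 = M j j * z j 0.
Proof.
move=> /is_trig_mxP hM z0.
have /existsP [j0 zj0] : [exists j, z j 0 != 0].
  apply: contraR z0; rewrite negb_exists => /forallP z0; apply/eqP/colP => j.
  by rewrite mxE; apply/eqP; rewrite -[_ == _]negbK.
case: (arg_minnP (fun j : 'I_d => j : nat) (P := fun j => z j 0 != 0) zj0) => j zj jmin.
exists j => //; rewrite mxE (bigD1 j) //= big1 ?addr0 // => l lj.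
have [jl|jl] := ltnP j l; first by rewrite hM ?mul0r.
suff -> : z l 0 = 0 by rewrite mulr0.
apply/eqP; apply: contraT => /jmin; rewrite leqNgt => /negP [].
by rewrite ltn_neqAle lj.
Qed.

End ComplexVectors.

(** * Covering polydiscs and their images in complex coordinates *)

Section Covers.
Context {R : realType} {d : nat}.
Local Notation C := R[i].
Implicit Types (z : 'cV[C]_d) (T : 'M[C]_d).

(** Mesh [r / 2] along both axes leaves an error of at most [r / 2] in the real and in the imaginary
    part. An axis of length [2 * rho j] then takes about [4 * rho j / r] steps. *)
Lemma box_cover (rho : 'I_d -> R) (r : R) : 0 < r -> (forall j, 0 <= rho j) ->
  exists2 Z : seq 'cV[C]_d, size Z = (\prod_j (Num.truncn (4 * rho j / r)).+1 ^ 2)%N &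
  forall z, (forall j, normc (z j 0) <= rho j) -> exists2 c, c \in Z & cbox r (z - c).
Proof.
move=> r0 rho0; pose n j := (Num.truncn (4 * rho j / r)).+1.
pose c (k : {ffun 'I_d -> 'I_(grid_bound n) * 'I_(grid_bound n)}) : 'cV[C]_d :=
  \col_j Complex (((k j).1 : nat)%:R * (r / 2) - rho j) (((k j).2 : nat)%:R * (r / 2) - rho j).
exists [seq c k | k in grid n].
  by rewrite size_image card_grid.
have h0 : 0 < r / 2 by rewrite divr_gt0.
move=> z zr.
pose a j (x : R) := Num.truncn ((x + rho j) / (r / 2)).
have aP j x : `|x| <= rho j -> (a j x < n j)%N /\ `|x - ((a j x)%:R * (r / 2) - rho j)| <= r / 2.
  rewrite ler_norml => /andP[x1 x2].
  have q0 : 0 <= (x + rho j) / (r / 2) by rewrite divr_ge0 ?(ltW h0) // -lerBlDr sub0r.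
  have /andP[t1 t2] := truncn_itv q0; split.
    rewrite ltnS /n; apply: le_truncn.
    rewrite ler_pdivrMr // [leRHS](_ : _ = 2 * rho j); last by field; rewrite gt_eqF.
    by rewrite mulr2n mulrDl mul1r lerD2r.
  move: t1 t2; rewrite -/(a j x) ler_pdivlMr // ltr_pdivrMr // => t1 t2.
  have t3 : (a j x).+1%:R * (r / 2) = (a j x)%:R * (r / 2) + r / 2.
    by rewrite -natr1 mulrDl mul1r.
  rewrite t3 in t2; rewrite ler_norml; apply/andP; split; lra.
have ab j x : `|x| <= rho j -> (a j x < grid_bound n)%N.
  by move=> /aP [h _]; rewrite (leq_trans h) // leqW // (leq_bigmax j).
have R1 j : `|complex.Re (z j 0)| <= rho j by exact: le_trans (normc_Re _) (zr j).
have I1 j : `|complex.Im (z j 0)| <= rho j by exact: le_trans (normc_Im _) (zr j).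
pose k : {ffun 'I_d -> 'I_(grid_bound n) * 'I_(grid_bound n)} :=
  [ffun j => (Ordinal (ab j _ (R1 j)), Ordinal (ab j _ (I1 j)))].
exists (c k).
  apply: map_f; rewrite mem_enum; apply/familyP => j; rewrite !inE ffunE /=.
  by rewrite (aP j _ (R1 j)).1 (aP j _ (I1 j)).1.
move=> j; rewrite !mxE ffunE /=; apply: (le_trans (normc_ReIm _)).
rewrite [leRHS](splitr r).
have [_ h1] := aP j _ (R1 j); have [_ h2] := aP j _ (I1 j).
move: h1 h2; case: (z j 0) => x y /= h1 h2; exact: lerD.
Qed.

(** The [j]-th coordinate of the image has modulus at most |T_jj| + 1, the off-diagonal part
    contributing at most 1. The 9 comes from 4 (a + 1) + 1 <= 9 max(1, a). *)
Lemma trig_cover T : (forall j, \sum_(l | l != j) normc (T j l) <= 1) ->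
  exists2 Z : seq 'cV[C]_d,
    (size Z)%:R <= \prod_j (9 * Num.max 1 (normc (T j j))) ^+ 2 :> R &
  forall z, cbox 1 z -> exists2 c, c \in Z & cbox 1 (T *m z - c).
Proof.
move=> T1; have rho0 j : 0 <= normc (T j j) + 1 by rewrite addr_ge0 // normc_ge0.
have [Z sZ HZ] := box_cover ltr01 rho0; exists Z; last first.
  move=> z z1; apply: HZ => j; rewrite mxE (bigD1 j) //=.
  rewrite (le_trans (le_normcD _ _)) // lerD //.
    by rewrite normcM ler_piMr // normc_ge0.
  apply: le_trans (T1 j); apply: (le_trans (normc_sum _ _)).
  by apply: ler_sum => l _; rewrite normcM ler_piMr // normc_ge0.
rewrite sZ natr_prod; apply: ler_prod => j _; rewrite ler0n /= natrX.
apply: lerXn2r; rewrite ?nnegrE ?mulr_ge0 ?le_max ?ler01 //.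
rewrite divr1 -natr1.
have t0 : 0 <= 4 * (normc (T j j) + 1) by rewrite mulr_ge0.
have /andP[t1 _] := truncn_itv t0.
have m1 : 1 <= Num.max 1 (normc (T j j)) by rewrite le_max lexx.
have m2 : normc (T j j) <= Num.max 1 (normc (T j j)) by rewrite le_max lexx orbT.
move: t1 m1 m2; generalize (normc (T j j)) (Num.max 1 (normc (T j j)))
  ((Num.truncn (4 * (normc (T j j) + 1)))%:R : R).
by move=> x y w *; lra.
Qed.

(** If T^k z differs from r c by an element of the polydisc of radius [r], covering the image of
    this difference by the rescaled [Z] yields the next centre T c + c'. The radius never grows, and
    [Zk] does not depend on [r]. *)
Lemma trig_cover_iter T (Z : seq 'cV[C]_d) :
  (forall z, cbox 1 z -> exists2 c, c \in Z & cbox 1 (T *m z - c)) ->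
  forall k, exists2 Zk : seq 'cV[C]_d, size Zk = (size Z ^ k)%N &
  forall r z, 0 < r -> cbox r z ->
    exists2 c, c \in Zk & cbox r (T ^+ k *m z - r%:C%C *: c).
Proof.
move=> HZ; have HZr r z : 0 < r -> cbox r z ->
    exists2 c, c \in Z & cbox r (T *m z - r%:C%C *: c).
  move=> r0 zr; have rC : (r%:C%C : C) != 0 by rewrite eq_complex /= gt_eqF.
  have [|c cZ hc] := HZ (r^-1%:C%C *: z).
    have := cboxZ (r^-1%:C%C) zr.
    by rewrite normc_real ger0_norm ?invr_ge0 ?(ltW r0) // mulVf // gt_eqF.
  exists c => //; have := cboxZ (r%:C%C) hc.
  rewrite normc_real mulr1 ger0_norm ?(ltW r0) // scalerBr -scalemxAr scalerA.
  suff -> : (r%:C%C * r^-1%:C%C : C) = 1 by rewrite scale1r.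
  by rewrite -[LHS](rmorphM (real_complex R)) mulfV ?gt_eqF.
elim=> [|k [Zk sZk HZk]].
  exists [:: 0]; first by rewrite expn0.
  move=> r z r0 zr; exists 0; first by rewrite mem_head.
  by rewrite scaler0 subr0 expr0 mul1mx.
exists [seq T *m c + c' | c <- Zk, c' <- Z].
  by rewrite size_allpairs sZk expnSr.
move=> r z r0 zr; have [c cZk hc] := HZk _ _ r0 zr.
have [c' cZ hc'] := HZr _ _ r0 hc.
exists (T *m c + c'); first by apply: allpairs_f.
move: hc'; congr (cbox r _).
rewrite [T ^+ k.+1]exprS mulmxBr -scalemxAr scalerDr opprD addrA.
by rewrite mulmxA.
Qed.

End Covers.

(** * From complex covers to covers of real sets *)

Section RealCovers.
Context {R : realType} {d : nat}.
Local Notation C := R[i].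
Implicit Types (x y : 'cV[R]_d) (A G : 'M[R]_d) (P : 'M[C]_d).

(** The real trace of the complex unit polydisc in the coordinates given by [P]. *)
Definition unitb P x := cbox 1 (P *m cvec x).

Lemma cboxN p (r : R) (z : 'cV[C]_p) : cbox r z -> cbox r (- z).
Proof. by move=> zr j; rewrite mxE normcN. Qed.

Lemma unitbN P x : unitb P x -> unitb P (- x).
Proof. by rewrite /unitb /cvec map_mxN mulmxN; exact: cboxN. Qed.

Definition separated P (Y : seq 'cV[R]_d) :=
  uniq Y /\ forall y y', y \in Y -> y' \in Y -> y != y' -> ~ unitb P (y - y').

Lemma conj_cplx_expr P G k (z : 'cV[C]_d) : P \in unitmx ->
  conj_cplx P G ^+ k *m (P *m z) = P *m (complexify (G ^+ k) *m z).
Proof. by move=> Pu; rewrite -conj_cplxX // /conj_cplx -!mulmxA mulKmx. Qed.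

Lemma complexify_mul_cvec G x y :
  complexify G *m (cvec x + 'i%C *: cvec y) = cvec (G *m x) + 'i%C *: cvec (G *m y).
Proof. by rewrite mulmxDr -scalemxAr -!cvec_mulmx. Qed.

(** Two points of [Y] are the real and imaginary parts of one complex vector, the image under
    [G ^+ k] of a vector of the polydisc of radius 2. Pairs that receive the same centres coincide,
    so the square of [size Y] is bounded by the complex count. [C0] counts the small polydiscs that
    start the iteration and is independent of [k]. *)
Lemma separated_card P G (Z : seq 'cV[C]_d) : P \in unitmx ->
  (forall z, cbox 1 z -> exists2 c, c \in Z & cbox 1 (conj_cplx P G *m z - c)) ->
  exists C0, forall k Y, separated P Y ->
    (forall y, y \in Y -> exists2 x, unitb P x & y = G ^+ k *m x) ->
    (size Y ^ 2 <= C0 * size Z ^ k)%N.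
Proof.
move=> Pu HZ; have [c1 c10 H1] := cbox_mulmx P; have [c2 c20 H2] := cbox_mulmx (invmx P).
(* Vectors sharing their centres differ by at most [e + e]; going through [invmx P] and back through
   [P] multiplies this by at most [c1 * c2], and the result must not exceed 1. *)
pose e : R := (2 * (c1 * c2 + 1))^-1.
have den : 0 < 2 * (c1 * c2 + 1) by rewrite mulr_gt0 // ltr_wpDl // mulr_ge0.
have e0 : 0 < e by rewrite invr_gt0.
have [Z0 _ HZ0] := @box_cover R d (fun=> 2) e e0 (fun=> ltW (ltr0n _ 2)).
exists (size Z0) => k Y [uY sY] GY.
have [Zk sZk HZk] := trig_cover_iter HZ k.
have : forall p : 'cV[R]_d * 'cV[R]_d, exists q : 'cV[C]_d * 'cV[C]_d,
    p.1 \in Y -> p.2 \in Y -> [/\ q.1 \in Z0, q.2 \in Zk &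
    cbox e (P *m (cvec p.1 + 'i%C *: cvec p.2) - (conj_cplx P G ^+ k *m q.1 + e%:C%C *: q.2))].
  move=> [y y'] /=.
  have [/andP[yY y'Y]|/negP h] := boolP ((y \in Y) && (y' \in Y)); last first.
    by exists (0, 0) => h1 h2; case: h; rewrite h1.
  have [x x1 yE] := GY _ yY; have [x' x1' yE'] := GY _ y'Y.
  pose v := P *m (cvec x + 'i%C *: cvec x').
  have v2 : cbox 2 v.
    have -> : (2 : R) = 1 + normc ('i%C : C) * 1.
      by rewrite /normc /= expr0n expr1n add0r sqrtr1 mulr1.
    by rewrite /v mulmxDr -scalemxAr; apply: cboxD => //; exact: cboxZ.
  have [c0 cZ0 hc0] := HZ0 _ v2.
  have [c cZk hc] := HZk e _ e0 hc0.
  exists (c0, c) => _ _; split; [exact: cZ0|exact: cZk|].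
  have vE : P *m (cvec y + 'i%C *: cvec y') = conj_cplx P G ^+ k *m v.
    by rewrite conj_cplx_expr // complexify_mul_cvec yE yE'.
  have E : P *m (cvec y + 'i%C *: cvec y') - (conj_cplx P G ^+ k *m c0 + e%:C%C *: c) =
      conj_cplx P G ^+ k *m (v - c0) - e%:C%C *: c.
    by rewrite vE mulmxBr opprD addrA.
  by rewrite [X in cbox e X]E.
move=> /choice [F HF].
pose YY := [seq (y, y') | y <- Y, y' <- Y].
have YYP p : p \in YY -> p.1 \in Y /\ p.2 \in Y by move=> /allpairsP [[a b] [/= ? ? ->]].
have uYY : uniq YY by apply: allpairs_uniq => // -[a b] [a' b'] _ _.
have injF : {in YY &, injective F}.
  move=> [y y'] [z z'] /YYP [/= yY y'Y] /YYP [/= zY z'Y] Fe.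
  have [_ _ h1] := HF (y, y') yY y'Y; have [_ _ h2] := HF (z, z') zY z'Y.
  rewrite Fe in h1; have h3 := cboxB h1 h2; move: h3 => /=.
  rewrite opprB addrA subrK -mulmxBr opprD addrACA -scalerBr -!cvecB => h3.
  have ee : 0 <= e + e by rewrite addr_ge0 // ltW.
  have := H2 _ _ ee h3; rewrite mulKmx // => /cvec_le [|h4 h5].
    by rewrite mulr_ge0.
  have smal (a b : 'cV[R]_d) : a \in Y -> b \in Y -> `|a - b| <= c2 * (e + e) -> a = b.
    move=> aY bY ab; apply/eqP; apply: contraT => /(sY _ _ aY bY) [].
    have g0 : 0 <= c2 * (e + e) by rewrite mulr_ge0.
    have := H1 _ _ g0 (cboxW ab (cbox_cvec (a - b))); apply: cboxW.
    rewrite mulrA -mulr2n -mulr_natl /e mulrA ler_pdivrMr // mul1r.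
    by rewrite mulrC ler_wpM2l // lerDl.
  by rewrite (smal _ _ yY zY h4) (smal _ _ y'Y z'Y h5).
have -> : (size Y ^ 2 = size [seq F p | p <- YY])%N by rewrite size_map size_allpairs.
have -> : (size Z0 * size Z ^ k = size [seq (a, b) | a <- Z0, b <- Zk])%N.
  by rewrite size_allpairs sZk.
apply: uniq_leq_size; first by rewrite map_inj_in_uniq.
move=> q /mapP [p /YYP [p1 p2] ->]; have [q1 q2 _] := HF p p1 p2.
by apply/allpairsP; exists (F p); split => //; case: (F p).
Qed.

(** A separated subset of the image of maximal size covers it, since a point far from all its
    members could be added. The maximum exists by [separated_card]. *)
Lemma separated_cover P G (Z : seq 'cV[C]_d) : P \in unitmx ->
  (forall z, cbox 1 z -> exists2 c, c \in Z & cbox 1 (conj_cplx P G *m z - c)) ->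
  exists C0, forall k, exists2 Y : seq 'cV[R]_d, (size Y ^ 2 <= C0 * size Z ^ k)%N &
    forall x, unitb P x -> exists2 y, y \in Y & unitb P (G ^+ k *m x - y).
Proof.
move=> Pu HZ; have [C0 HC0] := separated_card Pu HZ; exists C0 => k.
pose valid (Y : seq 'cV[R]_d) := separated P Y /\
  (forall y, y \in Y -> exists2 x, unitb P x & y = G ^+ k *m x).
pose Q n := `[< exists2 Y, valid Y & size Y = n >].
have exQ : exists n, Q n by exists 0%N; apply/asboolP; exists [::].
have leQ n : Q n -> (n <= C0 * size Z ^ k)%N.
  move=> /asboolP [Y [sY vY] <-]; apply: leq_trans (HC0 k Y sY vY).
  by rewrite -mulnn; case: (size Y) => // n'; rewrite leq_pmulr.
case: (ex_maxnP exQ leQ) => n /asboolP [Y [sY vY] sizeY] maxn.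
exists Y; first exact: HC0.
move=> x x1; apply: contrapT => noy.
have far y : y \in Y -> ~ unitb P (G ^+ k *m x - y) by move=> yY h; apply: noy; exists y.
have GxY : G ^+ k *m x \notin Y.
  apply/negP => /far; apply; rewrite subrr => j.
  by rewrite /cvec map_mx0 mulmx0 mxE normc0.
have : Q n.+1.
  apply/asboolP; exists (G ^+ k *m x :: Y); last by rewrite /= sizeY.
  split; last by move=> y; rewrite inE => /predU1P [->|/vY //]; exists x.
  split; first by rewrite /= GxY sY.1.
  move=> y y'; rewrite !inE => /predU1P [->|yY] /predU1P [->|y'Y].
  - by rewrite eqxx.
  - by move=> _; exact: far.
  - by move=> _ /unitbN; rewrite opprB; exact: far.
  - exact: sY.2.
by move=> /maxn; rewrite ltnn.
Qed.

End RealCovers.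

(** * Real covers at nearly the optimal exponential rate *)

Section EfficientCover.
Context {R : realType} {d : nat}.
Local Notation C := R[i].
Implicit Types (x y : 'cV[R]_d) (A G : 'M[R]_d) (P : 'M[C]_d).

(** Conjugation by the diagonal matrix of the powers s^j multiplies the entry in row [j] and column
    [l] by s^(j-l), which is 1 on the diagonal and at most [s] below it. As [m0] is the sum of all
    moduli, [s * m0] is at most 1. *)
Lemma offdiag_small G P : P \in unitmx -> is_trig_mx (conj_cplx P G) ->
  exists P' : 'M[C]_d, [/\ P' \in unitmx,
    forall j, conj_cplx P' G j j = conj_cplx P G j j &
    forall j, \sum_(l | l != j) normc (conj_cplx P' G j l) <= 1].
Proof.
move=> Pu; set T := conj_cplx P G => /is_trig_mxP hT.
pose m0 : R := \sum_j \sum_l normc (T j l).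
have row0 j : 0 <= \sum_l normc (T j l) by rewrite sumr_ge0 // => l _; exact: normc_ge0.
have m00 : 0 <= m0 by rewrite sumr_ge0.
have m1 : 0 < m0 + 1 by rewrite ltr_wpDl.
pose s : R := (m0 + 1)^-1.
have s0 : 0 < s by rewrite invr_gt0.
have s1 : s <= 1 by rewrite invf_le1 // lerDr.
pose D : 'M[C]_d := diag_mx (\row_j ((s ^+ j)%:C)%C).
have sC (k : nat) : ((s ^+ k)%:C)%C != 0 :> C by rewrite eq_complex /= gt_eqF // exprn_gt0.
have Du : D \in unitmx.
  rewrite unitmxE det_diag unitfE; apply/prodf_neq0 => j _; rewrite mxE; exact: sC.
have DPu : D *m P \in unitmx by rewrite unitmx_mul Du.
have TD : conj_cplx (D *m P) G *m D = D *m T.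
  have Pinv : invmx (D *m P) = invmx P *m invmx D.
    apply: (can_inj (mulKmx DPu)); rewrite mulmxV // -mulmxA (mulmxA P) mulmxV // mul1mx.
    by rewrite mulmxV.
  by rewrite /conj_cplx Pinv -!mulmxA mulVmx // mulmx1 /T /conj_cplx !mulmxA.
have E (S S' : 'M[C]_d) : S' *m D = D *m S -> forall j l,
    S' j l * ((s ^+ l)%:C)%C = ((s ^+ j)%:C)%C * S j l.
  move=> /matrixP H j l; move: (H j l).
  by rewrite /D mul_mx_diag mul_diag_mx !mxE.
have {}E := E _ _ TD.
exists (D *m P); split => // j.
  by have /mulIf := sC j; apply; rewrite E mulrC.
have le1 l : l != j -> normc (conj_cplx (D *m P) G j l) <= s * normc (T j l).
  move=> lj; have [jl|jl] := ltnP j l.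
    have := E j l; rewrite hT // mulr0 => /eqP; rewrite mulf_eq0 (negbTE (sC l)) orbF => /eqP ->.
    by rewrite normc0 mulr_ge0 ?(ltW s0) // normc_ge0.
  have {lj} lj : (l < j)%N by rewrite ltn_neqAle lj.
  have -> : conj_cplx (D *m P) G j l = ((s ^+ (j - l))%:C)%C * T j l.
    have /mulIf := sC l; apply; rewrite E mulrAC; congr (_ * _).
    by rewrite -[RHS](rmorphM (real_complex R)) -exprD subnK // ltnW.
  rewrite normcM normc_real ler_wpM2r ?normc_ge0 // ger0_norm ?exprn_ge0 ?(ltW s0) //.
  by rewrite -[leRHS]expr1 ler_wiXn2l ?(ltW s0) // subn_gt0.
apply: (@le_trans _ _ (s * m0)); last first.
  by rewrite /s mulrC ler_pdivrMr // mul1r lerDl.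
apply: (@le_trans _ _ (\sum_(l | l != j) s * normc (T j l))); first exact: ler_sum.
rewrite -mulr_sumr ler_wpM2l ?(ltW s0) //.
apply: (@le_trans _ _ (\sum_l normc (T j l))).
  by rewrite [leRHS](bigD1 j) //= lerDr normc_ge0.
by rewrite /m0 [leRHS](bigD1 j) //= lerDl sumr_ge0.
Qed.

(** Two constants must disappear in the rate. The factor 81 per coordinate is absorbed by a large
    [t], and [C0] by a large number [k] of iterations. [k] is chosen after [t], because the
    coordinates [P'], and with them [C0], depend on [t]. *)
Lemma efficient_cover A P : P \in unitmx -> is_trig_mx (conj_cplx P A) ->
  forall e : R, 0 < e -> exists tau P' (Y : seq 'cV[R]_d),
  [/\ 0 < tau, P' \in unitmx,
    (size Y)%:R <= expR (tau * (\sum_j Num.max 0 (complex.Re (conj_cplx P A j j)) + e)) &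
    forall x, unitb P' x ->
      exists2 y, y \in Y & unitb P' (expmx (tau *: A) *m x - y)].
Proof.
move=> Pu hT e e0; set h := \sum_j _.
(* The 16 comes from 9 <= exp(8), squared, for each of the [d] coordinates. *)
pose t : R := 16 * d%:R / e + 1.
have t0 : 0 < t by rewrite ltr_wpDl // divr_ge0 ?mulr_ge0 // ltW.
have te : 16 * d%:R <= t * e.
  by rewrite [leRHS]mulrDl mul1r divfK ?gt_eqF // lerDl ltW.
have [P' [P'u dE off]] := offdiag_small Pu (conj_expmx_trig Pu hT t).
have [Z sZ HZ] := trig_cover off.
have [C0 HC0] := separated_cover P'u HZ.
have [k /andP[k0 kC]] : exists k : nat, (0 < k)%N && (C0%:R <= k%:R * (t * e)).
  have te0 : 0 < t * e by rewrite mulr_gt0.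
  exists (Num.truncn (C0%:R / (t * e))).+1; rewrite ltn0Sn /=.
  rewrite -ler_pdivrMr //; apply: ltW; exact: truncnS_gt.
have [Y sY HY] := HC0 k.
exists (k%:R * t), P', Y; split => //.
- by rewrite mulr_gt0 // ltr0n.
- have E0 : 0 <= expR (k%:R * t * (h + e)) by exact: expR_ge0.
  (* After squaring, the exponent has slack 2 k t e: one half pays for [C0], the other for the terms
     16 d. *)
  rewrite -(@ler_pXn2r _ 2) ?nnegrE ?ler0n // -natrX.
  apply: (@le_trans _ _ ((C0 * size Z ^ k)%N%:R)); first by rewrite ler_nat.
  rewrite natrM natrX -expRM_natl.
  have sZ' : (size Z)%:R <= expR (16 * d%:R + 2 * t * h).
    apply: (le_trans sZ).
    have -> : expR (16 * d%:R + 2 * t * h) =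
        \prod_(j < d) expR (16 + 2 * t * Num.max 0 (complex.Re (conj_cplx P A j j))).
      rewrite -expR_sum; congr expR; rewrite big_split /= sumr_const card_ord -mulr_sumr.
      by rewrite mulr_natr.
    apply: ler_prod => j _; rewrite exprn_ge0 ?mulr_ge0 ?le_max ?ler01 //=.
    rewrite dE (conj_expmx_diag Pu hT).
    set l := complex.Re _.
    have -> : Num.max 1 (expR (t * l)) = expR (t * Num.max 0 l).
      have [l0|l0] := leP 0 l.
        rewrite max_r // -[X in X <= _]expR0 ler_expR; exact: mulr_ge0 (ltW t0) l0.
      rewrite mulr0 expR0 max_l // -[leRHS]expR0 ler_expR.
      by rewrite pmulr_rle0 // ltW.
    rewrite exprMn -expRM_natl -mulrA.
    rewrite expRD; apply: ler_pM => //; rewrite ?expR_ge0 ?exprn_ge0 //.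
    have -> : (16 : R) = 2%:R * 8 by ring.
    rewrite expRM_natl; apply: lerXn2r; rewrite ?nnegrE ?expR_ge0 //.
    by have := expR_ge1Dx (8 : R); rewrite [1 + 8](_ : _ = 9) //; ring.
  apply: (@le_trans _ _ (expR (C0%:R) * expR (16 * d%:R + 2 * t * h) ^+ k)).
    apply: ler_pM => //; rewrite ?exprn_ge0 //.
      by apply: le_trans (expR_ge1Dx _); rewrite lerDr.
    by apply: lerXn2r; rewrite ?nnegrE ?expR_ge0.
  rewrite -expRM_natl -expRD ler_expR.
  have k0' : 0 <= k%:R :> R by [].
  have : k%:R * (16 * d%:R) <= k%:R * (t * e) by rewrite ler_wpM2l.
  have fin (a b c u v w : R) : b <= a * (u * w) -> a * (16 * c) <= a * (u * w) ->
      b + a * (16 * c + 2 * u * v) <= 2 * (a * u * (v + w)).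
    move=> h1 h2; rewrite -subr_ge0.
    have -> : 2 * (a * u * (v + w)) - (b + a * (16 * c + 2 * u * v)) =
      (a * (u * w) - b) + (a * (u * w) - a * (16 * c)) by ring.
    by rewrite addr_ge0 // subr_ge0.
  exact: fin.
- move=> x x1; have [y yY hy] := HY _ x1; exists y => //.
  suff -> : expmx (k%:R * t *: A) = expmx (t *: A) ^+ k by [].
  elim: (k) => [|n IH]; first by rewrite mul0r expmx0 expr0.
  by rewrite exprmxS -IH -expmxD -natr1 mulrDl mul1r addrC.
Qed.

End EfficientCover.

(** * Bounded loops *)

Section Loops.
Context {R : realType}.

(** For [q < 1] the bound propagates forward from [a 0], for [q > 1] backward from [a n]. It rests
    on the fixed point of a -> q a + c or of a -> (a + c) / q; the extra [c] in the second case
    covers the end value. *)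
Lemma scalar_loop (q c : R) : 0 <= q -> q != 1 -> 0 <= c -> exists2 M, 0 <= M &
  forall n (a : nat -> R), a 0%N <= c -> a n <= c ->
    (forall i, (i < n)%N -> a i.+1 <= q * a i + c /\ q * a i <= a i.+1 + c) ->
    forall i, (i <= n)%N -> a i <= M.
Proof.
move=> q0 q1 c0; have [lt1|gt1|] := ltgtP q 1; last by move/eqP; rewrite (negbTE q1).
  have d0 : 0 < 1 - q by rewrite subr_gt0.
  exists (c / (1 - q)); first by rewrite divr_ge0 // ltW.
  move=> n a a0 _ ha; elim=> [|i IH] ile.
    by apply: (le_trans a0); rewrite ler_pdivlMr // ler_piMr // lerBlDr lerDl.
  apply: (le_trans (ha i ile).1).
  have -> : c / (1 - q) = q * (c / (1 - q)) + c by field; rewrite gt_eqF.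
  by rewrite lerD2r ler_wpM2l // IH // ltnW.
have d0 : 0 < q - 1 by rewrite subr_gt0.
have q0' : 0 < q by exact: lt_trans gt1.
have M0 : 0 <= c / (q - 1) by rewrite divr_ge0 // ltW.
exists (c / (q - 1) + c); first by rewrite addr_ge0.
move=> n a _ an ha i ile; rewrite -(subKn ile); elim: (n - i)%N (leq_subr i n) => [|k IH] kn.
  by rewrite subn0 (le_trans an) // lerDr.
have h2 := IH (ltnW kn); have lt1 : (n - k.+1 < n)%N by rewrite ltn_subrL (leq_ltn_trans _ kn).
have [_ h1] := ha _ lt1; rewrite (subnSK kn) in h1.
rewrite -(ler_pM2l q0'); apply: (le_trans h1).
have -> : q * (c / (q - 1) + c) = (c / (q - 1) + c) + c + (q - 1) * c by field; rewrite gt_eqF.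
rewrite -addrA; apply: lerD => //; rewrite lerDl; apply: mulr_ge0 => //; exact: ltW.
Qed.

(** Induction on the number of coordinates: in row [j0] the earlier coordinates, already bounded,
    act as a further bounded error, and [scalar_loop] treats the coordinate itself. *)
Lemma trig_loop d (T : 'M[R[i]]_d) (c : R) : is_trig_mx T ->
  (forall j, normc (T j j) != 1) -> 0 <= c ->
  exists2 M, 0 <= M & forall n (y : nat -> 'cV[R[i]]_d),
    cbox c (y 0%N) -> cbox c (y n) ->
    (forall i, (i < n)%N -> cbox c (y i.+1 - T *m y i)) ->
    forall i, (i <= n)%N -> cbox M (y i).
Proof.
move=> /is_trig_mxP hT T1 c0.
suff H k : exists2 M, 0 <= M & forall n (y : nat -> 'cV[R[i]]_d),
    cbox c (y 0%N) -> cbox c (y n) ->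
    (forall i, (i < n)%N -> cbox c (y i.+1 - T *m y i)) ->
    forall i, (i <= n)%N -> forall j : 'I_d, (j < k)%N -> normc (y i j 0) <= M.
  have [M M0 HM] := H d; exists M => // n y y0 yn hy i ile j.
  exact: (HM n y y0 yn hy i ile j (ltn_ord j)).
elim: k => [|k [M M0 IH]]; first by exists 0 => // n y _ _ _ i _ j; rewrite ltn0.
have [kd|dk] := ltnP k d; last first.
  exists M => // n y y0 yn hy i ile j jk.
  by apply: (IH n y) => //; exact: leq_trans (ltn_ord j) dk.
pose j0 := Ordinal kd.
pose b := c + \sum_l normc (T j0 l) * M.
have s0 : 0 <= \sum_l normc (T j0 l) * M.
  by rewrite sumr_ge0 // => l _; rewrite mulr_ge0 // normc_ge0.
have b0 : 0 <= b by rewrite addr_ge0.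
have cb : c <= b by rewrite lerDl.
have [M' M'0 HM'] := scalar_loop (normc_ge0 _) (T1 j0) b0.
exists (Num.max M M'); first by rewrite le_max M0.
move=> n y y0 yn hy i ile j; rewrite ltnS leq_eqVlt le_max => /predU1P [jk|jk]; last first.
  by apply/orP; left; exact: IH ile j jk.
apply/orP; right; have -> : j = j0 by exact: val_inj.
apply: (HM' n (fun i => normc (y i j0 0))) => //.
- exact: le_trans (y0 j0) cb.
- exact: le_trans (yn j0) cb.
move=> {}i {ile}ilt.
pose r := y i.+1 j0 0 - T j0 j0 * y i j0 0.
have rb : normc r <= b.
  have rE : r = (y i.+1 - T *m y i) j0 0 + \sum_(l | l != j0) T j0 l * y i l 0.
    by rewrite /r !mxE (bigD1 j0) //= opprD addrA subrK.
  rewrite rE (le_trans (le_normcD _ _)) // lerD //; first exact: hy.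
  apply: (le_trans (normc_sum _ _)); rewrite [leRHS](bigD1 j0) //=.
  rewrite -[leLHS]add0r; apply: lerD; first by rewrite mulr_ge0 // normc_ge0.
  apply: ler_sum => l lj; rewrite normcM.
  have [lk|kl] := ltnP l k.
    by rewrite ler_wpM2l ?normc_ge0 // (IH n y) // ltnW.
  rewrite hT; first by rewrite normc0 !mul0r.
  by rewrite ltn_neqAle kl andbT eq_sym.
split.
  have -> : y i.+1 j0 0 = T j0 j0 * y i j0 0 + r by rewrite /r addrC subrK.
  by rewrite (le_trans (le_normcD _ _)) // normcM lerD2l.
rewrite -normcM.
have -> : T j0 j0 * y i j0 0 = y i.+1 j0 0 - r by rewrite /r subKr.
by rewrite (le_trans (le_normcD _ _)) // normcN lerD2l.
Qed.

Lemma spectrum_diag d (A : 'M[R]_d) P : P \in unitmx -> is_trig_mx (conj_cplx P A) ->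
  forall j, spectrum A (conj_cplx P A j j).
Proof.
move=> Pu hT j; rewrite /spectrum /= eigenvalue_root_char -(char_poly_conj _ Pu).
rewrite -/(conj_cplx P A) char_poly_trig //; apply/rootP.
by rewrite horner_prod (bigD1 j) //= hornerXsubC subrr mul0r.
Qed.

(** Hyperbolicity makes the diagonal moduli exp(Re lambda) of the time-one map different from 1.
    Since [M] is independent of [n], arbitrarily long excursions are controlled. *)
Lemma real_loop d (A : 'M[R]_d) (c : R) : hyperbolic A -> 0 <= c ->
  exists2 M, 0 <= M & forall n (y : nat -> 'cV[R]_d), `|y 0%N| <= c -> `|y n| <= c ->
    (forall i, (i < n)%N -> `|y i.+1 - expmx (1 *: A) *m y i| <= c) ->
    forall i, (i <= n)%N -> `|y i| <= M.
Proof.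
move=> hA c0; have [P Pu hT] := complexify_trig A.
have {}hT : is_trig_mx (conj_cplx P A) by [].
have [c1 c10 H1] := cbox_mulmx P; have [c2 c20 H2] := cbox_mulmx (invmx P).
have T1 j : normc (conj_cplx P (expmx (1 *: A)) j j) != 1.
  rewrite conj_expmx_diag // mul1r -expR0; apply: contra (hA _ (spectrum_diag Pu hT j)).
  by move=> /eqP /expR_inj ->.
have c10' : 0 <= c1 * c by rewrite mulr_ge0.
have [M M0 HM] := trig_loop (conj_expmx_trig Pu hT 1) T1 c10'.
exists (c2 * M); first by rewrite mulr_ge0.
move=> n y y0 yn hy i ile.
have cb (x : 'cV[R]_d) : `|x| <= c -> cbox (c1 * c) (P *m cvec x).
  by move=> xc; apply: H1 => //; exact: cboxW xc (cbox_cvec x).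
have hz : cbox M (P *m cvec (y i)).
  apply: (HM n (fun i => P *m cvec (y i)) (cb _ y0) (cb _ yn)) => // k kn.
  rewrite /conj_cplx -!mulmxA mulKmx // -cvec_mulmx -mulmxBr -cvecB.
  exact/cb/hy.
have := H2 _ _ M0 hz; rewrite mulKmx // => h.
apply: mx_norm_le => [|a b]; first by rewrite mulr_ge0.
by have := h a; rewrite mxE normc_real ord1.
Qed.

End Loops.

(** * Control sets *)

(* Unification would otherwise unfold trajectories to limits and integrals. *)
Opaque trajectory expmx.

Section ControlSets.
Context {R : realType} {d m : nat}.
Variables (A : 'M[R]_d) (B : 'M[R]_(d, m)) (U : set 'cV[R]_m).
Hypothesis cU : compact U.
Implicit Types (x y z : 'cV[R]_d) (w v : R -> 'cV[R]_m) (D : set 'cV[R]_d).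

Let cvl w : controls U w -> vlocb w := controls_vlocb cU.

Lemma closure_normP (S : set 'cV[R]_d) x :
  closure S x <-> forall e : R, 0 < e -> exists2 y, S y & `|x - y| < e.
Proof.
split=> [Sx e e0|H V /nbhs_normP [e /= e0 He]].
  have [|y [Sy ye]] := Sx (ball x e); first exact: nbhsx_ballx.
  by exists y => //; move: ye; rewrite -ball_normE.
have [y Sy xy] := H e e0; exists y; split => //; exact: He.
Qed.

Lemma trajectory_close t x w e : 0 < e -> exists2 r : R, 0 < r &
  forall y, `|x - y| < r -> `|trajectory A B t x w - trajectory A B t y w| < e.
Proof.
move=> e0; pose c := d%:R * `|expmx (t *: A)|.
have c0 : 0 <= c by rewrite mulr_ge0.
have c1 : 0 < c + 1 by rewrite ltr_wpDl.
exists (e / (c + 1)); first by rewrite divr_gt0.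
move=> y xy; rewrite trajectory_sub (le_lt_trans (mx_norm_mul _ _)) //.
rewrite -/c (@le_lt_trans _ _ (c * (e / (c + 1)))) //.
  by rewrite ler_wpM2l // ltW.
by rewrite mulrCA gtr_pMr // ltr_pdivrMr // mul1r ltrDl.
Qed.

Lemma positive_orbit_trans x y s w : positive_orbit A B U x y -> controls U w ->
  0 <= s -> positive_orbit A B U x (trajectory A B s y w).
Proof.
move=> [t [v [t0 Uv <-]]] Uw s0; exists (t + s), (concat t v w).
split; first by rewrite ltr_wpDr.
  exact: controls_concat.
exact: (trajectory_concat_ge A B x (cvl Uv) (cvl Uw) (ltW t0) s0).
Qed.

Lemma positive_orbit_sub x y : positive_orbit A B U x y ->
  positive_orbit A B U y `<=` positive_orbit A B U x.
Proof.
move=> xy _ [s [w [s0 Uw <-]]]; apply: positive_orbit_trans => //; exact: ltW.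
Qed.

(* The union of a control set and an arc with endpoints in it still has the
   defining property, so by maximality the arc lies in the control set. *)
Lemma control_set_arc D x w t : control_set A B U D -> D x -> controls U w ->
  0 <= t -> D (trajectory A B t x w) ->
  forall s, 0 <= s <= t -> D (trajectory A B s x w).
Proof.
move=> [[Dinv Dorb] Dmax] Dx Uw t0 Dy s st.
pose arc := [set p | exists2 s, 0 <= s <= t & p = trajectory A B s x w].
suff H : control_set_prop A B U (D `|` arc).
  rewrite -(Dmax _ H (@subsetUl _ D arc)); right; by exists s.
have bw := cvl Uw.
have arcE s0 : 0 <= s0 <= t ->
    trajectory A B (t - s0) (trajectory A B s0 x w) (fun r => w (s0 + r)) =
    trajectory A B t x w.
  move=> /andP[s1 s2]; have ts : 0 <= t - s0 by rewrite subr_ge0.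
  have := trajectory_cocycle A B x bw s1 ts.
  rewrite (_ : s0 + (t - s0) = t); last by rewrite addrC subrK.
  exact: esym.
split.
  move=> z [Dz|[s0 s0t zE]].
    by have [v Uv Hv] := Dinv _ Dz; exists v => // r r0; left; exact: Hv.
  have [v Uv Hv] := Dinv _ Dy; have Usw := controls_shift s0 Uw.
  exists (concat (t - s0) (fun r => w (s0 + r)) v); first exact: controls_concat.
  move=> r r0; have [rt|/ltW tr] := leP r (t - s0).
    right; exists (s0 + r).
      by case/andP: s0t => s1 s2; rewrite addr_ge0 //= -lerBrDl.
    rewrite (trajectory_concat_le A B z (cvl Usw) (cvl Uv) rt).
    case/andP: s0t => s1 _; rewrite zE.
    exact/esym/(trajectory_cocycle A B x bw s1 r0).
  left; have -> : r = (t - s0) + (r - (t - s0)) by rewrite addrC subrK.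
  have ts0 : 0 <= t - s0 by rewrite subr_ge0; case/andP: s0t.
  have rts : 0 <= r - (t - s0) by rewrite subr_ge0.
  rewrite (trajectory_concat_ge A B z (cvl Usw) (cvl Uv) ts0 rts).
  by rewrite zE arcE //; exact: Hv.
have claim1 z : (D `|` arc) z -> D `<=` closure (positive_orbit A B U z).
  move=> [Dz|[s0 s0t zE]]; first exact: Dorb.
  (* At [s0 = t] the point is the endpoint, which lies in [D]; before that the remaining time is
     strictly positive, as [positive_orbit] demands. *)
  move: s0t zE; have [-> _ ->|ns s0t ->] := eqVneq s0 t; first exact: Dorb.
  apply: (subset_trans (Dorb _ Dy)); apply: closureS; apply: positive_orbit_sub.
  exists (t - s0), (fun r => w (s0 + r)); split.
  - by rewrite subr_gt0 lt_neqAle ns; case/andP: s0t.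
  - exact: controls_shift.
  - exact: (arcE _ s0t).
(* A point of the arc is approximated by first approximating the initial point [x], which lies in
   [D], and then following [w]. *)
move=> z Ez p [Dp|[s0 s0t ->]]; first exact: claim1 Dp.
apply/closure_normP => e e0.
have [r r0 Hr] := trajectory_close s0 x w e0.
have /closure_normP /(_ r r0) [x' zx' xx'] := claim1 _ Ez _ Dx.
exists (trajectory A B s0 x' w); last exact: Hr.
by apply: positive_orbit_trans => //; case/andP: s0t.
Qed.

(** Run from [x0] to a point [x'] near [x] and from there back to near [x0]. Sampled at integer
    times, this loop follows exp(A) up to bounded errors, so [real_loop] bounds it independently of
    its duration. *)
Lemma control_set_bounded D x0 : hyperbolic A -> control_set_prop A B U D -> D x0 ->
  exists2 C, 0 <= C & forall x, D x -> `|x| <= C.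
Proof.
move=> hA [Dinv Dorb] Dx0.
have [M0 [_ HM0]] := compact_bounded cU; pose M := Num.max 0 (M0 + 1).
have M_ge0 : 0 <= M by rewrite le_max lexx.
have UM w s : controls U w -> `|w s| <= M.
  by move=> [_ Uw]; rewrite le_max (HM0 (M0 + 1)) ?orbT // ltrDl.
have [C1 [C10 HC1]] := trajectory_bound A B ler01 M_ge0.
have HC t c x w : 0 <= t <= 1 -> 1 <= c -> controls U w -> `|x| <= c ->
    `|trajectory A B t x w| <= C1 * c.
  move=> t01 c1 Uw xc; apply: HC1 => //; [exact: le_trans c1|exact: cvl|].
  by move=> s _; apply: (le_trans (UM w s Uw)); rewrite ler_peMr.
pose c := C1 * (`|x0| + 3) + (`|x0| + 3).
have x3 : 1 <= `|x0| + 3 by rewrite -[leLHS]add0r lerD // ler1n.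
have x30 : 0 <= `|x0| + 3 by exact: le_trans x3.
have c0 : 0 <= c by rewrite addr_ge0 // mulr_ge0.
have [C2 C20 HC2] := real_loop hA c0.
exists (C1 * (C2 + 1) + 1); first by rewrite addr_ge0 // mulr_ge0 // addr_ge0.
move=> x Dx.
(* The return control comes first, since it decides how close [x'] must be to [x]. *)
have /closure_normP /(_ 1 ltr01) [y [t2 [w2 [t20 Uw2 yE]]] x0y] := Dorb _ Dx _ Dx0.
have [r r0 Hr] := trajectory_close t2 x w2 ltr01.
have r1 : 0 < Num.min r 1 by rewrite lt_min r0 ltr01.
have /closure_normP /(_ _ r1) [x' [t1 [w1 [t10 Uw1 xE]]] xx'] := Dorb _ Dx0 _ Dx.
move: xx'; rewrite lt_min => /andP[xx'r xx'1].
pose W := concat t1 w1 w2.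
have UW : controls U W by exact: controls_concat.
have bW := cvl UW.
pose Y (i : nat) := trajectory A B i%:R x0 W.
have Wt1 : trajectory A B t1 x0 W = x'.
  by rewrite (trajectory_concat_le A B x0 (cvl Uw1) (cvl Uw2) (lexx t1)).
have Wend : `|trajectory A B (t1 + t2) x0 W| <= `|x0| + 3.
  rewrite (trajectory_concat_ge A B x0 (cvl Uw1) (cvl Uw2) (ltW t10) (ltW t20)).
  rewrite xE; have h1 := Hr _ xx'r; rewrite yE in h1.
  set q := trajectory A B t2 x' w2 in h1 *.
  have -> : q = x0 - (x0 - y) - (y - q) by rewrite subKr subKr.
  rewrite (le_trans (ler_normB _ _)) // (le_trans (lerD (ler_normB _ _) (lexx _))) //.
  by rewrite -addrA lerD2l; apply: (@le_trans _ _ (1 + 1)); [rewrite lerD // ltW|lra].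
(* [N] is the first integer after the end of the loop, less than or equal to one time unit away; [n]
   is the last integer not after the time [t1] at which [x'] is reached. *)
pose N := (Num.truncn (t1 + t2)).+1; pose n := Num.truncn t1.
have t12 : 0 <= t1 + t2 by rewrite addr_ge0 // ltW.
have /andP[T1 T2] := truncn_itv t12.
have /andP[n1 n2] := truncn_itv (ltW t10).
have nN : (n <= N)%N.
  by rewrite /N leqW //; apply: le_truncn; rewrite lerDl ltW.
have step i : `|Y i.+1 - expmx (1 *: A) *m Y i| <= c.
  rewrite /Y -natr1 (trajectory_cocycle A B x0 bW (ler0n _ i) ler01) trajectoryE addrC addKr.
  have := HC 1 1 0 (fun s => W (i%:R + s)).
  rewrite ler01 lexx => /(_ isT isT (controls_shift _ UW)).
  rewrite normr0 => /(_ ler01); rewrite trajectoryE mulmx0 add0r => /le_trans; apply.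
  by rewrite /c mulr1 -[leLHS]addr0; apply: lerD => //; rewrite ler_peMr.
have Y0 : `|Y 0%N| <= c.
  rewrite /Y trajectory0 /c -[leLHS]add0r; apply: lerD; first by rewrite mulr_ge0.
  by rewrite lerDl.
have YN : `|Y N| <= c.
  rewrite /Y; have -> : N%:R = (t1 + t2) + (N%:R - (t1 + t2)) by rewrite addrC subrK.
  have NT : 0 <= N%:R - (t1 + t2) by rewrite subr_ge0 ltW.
  rewrite (trajectory_cocycle A B x0 bW t12 NT).
  have := HC (N%:R - (t1 + t2)) (`|x0| + 3) _ _ _ x3 (controls_shift (t1 + t2) UW) Wend.
  rewrite NT lerBlDr /N -natr1 addrC lerD2l T1 => /(_ isT) /le_trans; apply.
  by rewrite /c lerDl.
have Yn := HC2 N Y Y0 YN (fun i _ => step i) n nN.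
have t1n : 0 <= t1 - n%:R <= 1.
  by rewrite subr_ge0 n1 lerBlDr addrC natr1 ltW.
have c21 : 1 <= C2 + 1 by rewrite lerDr.
have x'b : `|x'| <= C1 * (C2 + 1).
  rewrite -Wt1; have -> : t1 = n%:R + (t1 - n%:R) by rewrite addrC subrK.
  have t1n0 : 0 <= t1 - n%:R by case/andP: t1n.
  rewrite (trajectory_cocycle A B x0 bW (ler0n _ n) t1n0).
  apply: HC => //; first exact: controls_shift.
  by apply: (le_trans Yn); rewrite lerDl.
have -> : x = x' + (x - x') by rewrite addrC subrK.
by rewrite (le_trans (ler_normD _ _)) // lerD // ltW.
Qed.

End ControlSets.

(** * Upper bound *)

Section LocalControls.
Context {R : realType} {d m : nat}.
Variables (A : 'M[R]_d) (B : 'M[R]_(d, m)) (U : set 'cV[R]_m).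
Hypothesis cU : compact U.
Hypothesis cAB : controllable A B.
Variables (D : set 'cV[R]_d) (f : 'cV[R]_m -> R) (w0 : 'cV[R]_m) (x0 : 'cV[R]_d).
Hypothesis cf : {within U, continuous f}.
Hypothesis Uw0 : U° w0.
Hypothesis Dx0 : D° x0.
Hypothesis eq0 : A *m x0 + B *m w0 = 0.
Implicit Types (x y z : 'cV[R]_d) (w v : R -> 'cV[R]_m).

Lemma unitb_bounded (P : 'M[R[i]]_d) : P \in unitmx ->
  exists2 c, 0 <= c & forall x, unitb P x -> `|x| <= c.
Proof.
move=> Pu; have [c c0 H] := cbox_mulmx (invmx P); exists c => // x x1.
have := H _ _ ler01 x1; rewrite mulKmx // mulr1 => h.
apply: mx_norm_le => // i j; have := h i; by rewrite mxE normc_real ord1.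
Qed.

Lemma continuous_vlocb v : continuous v -> vlocb v.
Proof.
move=> cv i; apply: locb_continuous => s.
apply: (@continuous_comp _ _ _ v (fun x : 'cV[R]_m => x i 0)); first exact: cv.
exact: coord_continuous.
Qed.

Lemma near_equilibrium_control e : 0 < e -> exists2 r : R, 0 < r &
  forall u, `|w0 - u| < r -> U u /\ f u <= f w0 + e.
Proof.
move=> e0; have Uw : U w0 by exact: interior_subset.
have /subspace_continuousP /(_ w0 Uw) /cvgrPdist_lt /(_ _ e0) fe := cf.
have fe' : nbhs w0 [set u | U u -> `|f w0 - f u| < e] by exact: fe.
have : nbhs w0 [set u | U u /\ f u <= f w0 + e].
  apply: filterS (filterI (Uw0 : nbhs w0 U) fe') => u [Uu /(_ Uu)] /=.
  by rewrite ltr_norml => /andP[h _]; split => //; rewrite -lerBlDl ltW // -ltrN2 opprB.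
move=> /nbhs_normP [r /= r0 Hr]; exists r => // u; exact: Hr.
Qed.

(** The control [v' i] steers the origin to minus the [i]-th centre. By linearity it carries a point
    x of the unit body covered by that centre to exp(tau A) x minus the centre, back inside the
    body. Scaling by [dl] and moving the origin to the equilibrium at [x0] and [w0] preserves
    this. *)
Lemma local_controls (tau : R) P (Y : seq 'cV[R]_d) e : 0 < tau -> P \in unitmx -> 0 < e ->
  (forall x, unitb P x -> exists2 y, y \in Y & unitb P (expmx (tau *: A) *m x - y)) ->
  exists (v : 'I_(size Y) -> R -> 'cV[R]_m) (K1 : set 'cV[R]_d),
  [/\ forall i, controls U (v i), forall i t, f (v i t) <= f w0 + e,
      forall x, K1 x -> exists2 i, K1 (trajectory A B tau x (v i)) &
        forall t, 0 <= t <= tau -> D (trajectory A B t x (v i)) &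
      exists2 r : R, 0 < r & forall x, `|x0 - x| < r -> K1 x].
Proof.
move=> tau0 Pu e0 HY.
have [rU rU0 HU] := near_equilibrium_control e0.
have [rD rD0 HD] : exists2 r : R, 0 < r & forall x, `|x0 - x| < r -> D x.
  by have /nbhs_normP [r /= r0 Hr] := Dx0; exists r => // x; exact: Hr.
have [cP cP0 HcP] := unitb_bounded Pu.
have [c1 c10 Hc1] := cbox_mulmx P.
have /choice [v' Hv'] (i : 'I_(size Y)) :
    exists v, continuous v /\ trajectory A B tau 0 v = - Y`_i.
  by have [v cv vE] := reachable (- Y`_i) cAB tau0; exists v.
have bv i := continuous_vlocb (Hv' i).1.
have /choice [M HM] (i : 'I_(size Y)) : exists M, forall s, 0 <= s <= tau -> `|v' i s| <= M.
  have /choice [N HN] (k : 'I_m) := (bv i k).2 tau.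
  exists (\sum_k `|N k|) => s /andP[s0 st]; apply: mx_norm_le => [|k j].
    by rewrite sumr_ge0.
  rewrite ord1 (bigD1 k) //= (le_trans (HN k s _)) //; first by rewrite ger0_norm.
  by rewrite (le_trans (ler_norm _)) // lerDl sumr_ge0.
pose Mx := \sum_i `|M i|.
have Mx0 : 0 <= Mx by rewrite sumr_ge0.
have HMx i s : 0 <= s <= tau -> `|v' i s| <= Mx.
  move=> /(HM i) h; apply: (le_trans h); rewrite /Mx (bigD1 i) //=.
  by rewrite (le_trans (ler_norm _)) // lerDl sumr_ge0.
have [C1 [C10 HC1]] := trajectory_bound A B (ltW tau0) Mx0.
have cP1 : 0 < cP + 1 by rewrite ltr_wpDl.
have HC t x i : 0 <= t <= tau -> unitb P x ->
    `|trajectory A B t x (v' i)| <= C1 * (cP + 1).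
  move=> t0 x1; apply: (HC1 t (cP + 1) x (v' i) t0 (ltW cP1) (bv i)).
    move=> s /andP[s0 st]; apply: (le_trans (HMx i s _)).
      by rewrite s0 /=; case/andP: t0 => _; exact: le_trans.
    by rewrite ler_peMr // lerDr.
  by rewrite (le_trans (HcP _ x1)) // lerDl.
(* The first bound keeps the control values within [rU] of [w0], the second the trajectories within
   [rD] of [x0]. *)
pose dl := Num.min (rU / (Mx + 1)) (rD / (C1 * (cP + 1) + 1)).
have Mx1 : 0 < Mx + 1 by rewrite ltr_wpDl.
have C11 : 0 < C1 * (cP + 1) + 1 by rewrite ltr_wpDl // mulr_ge0 // ltW.
have dl0 : 0 < dl by rewrite lt_min !divr_gt0.
have dlU a : a <= Mx -> dl * a < rU.
  move=> aM; apply: (@le_lt_trans _ _ (dl * Mx)); first by rewrite ler_pM2l.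
  apply: (@lt_le_trans _ _ (dl * (Mx + 1))); first by rewrite ltr_pM2l // ltrDl.
  by rewrite -ler_pdivlMr // ge_min lexx.
have dlD a : a <= C1 * (cP + 1) -> dl * a < rD.
  move=> aM; apply: (@le_lt_trans _ _ (dl * (C1 * (cP + 1)))); first by rewrite ler_pM2l.
  apply: (@lt_le_trans _ _ (dl * (C1 * (cP + 1) + 1))); first by rewrite ltr_pM2l // ltrDl.
  by rewrite -ler_pdivlMr // ge_min lexx orbT.
have inU i s : 0 <= s <= tau -> U (w0 + dl *: v' i s) /\ f (w0 + dl *: v' i s) <= f w0 + e.
  move=> st; apply: HU; rewrite opprD addrA subrr sub0r normrN normrZ (ger0_norm (ltW dl0)).
  exact/dlU/HMx.
have [Uw fw] : U w0 /\ f w0 <= f w0 + e by apply: HU; rewrite subrr normr0.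
pose v i s := if (0 <= s) && (s <= tau) then w0 + dl *: v' i s else w0.
exists v, (fun x => unitb P (dl^-1 *: (x - x0))).
have cv i : continuous (fun s => w0 + dl *: v' i s).
  move=> s; apply: cvgD; first exact: cvg_cst.
  by apply: cvgZ; [exact: cvg_cst|exact: (Hv' i).1].
have Uv i : controls U (v i).
  by apply: continuous_controls => // s /(inU i) [].
have trE t i x : 0 <= t <= tau -> trajectory A B t x (v i) =
    x0 + dl *: trajectory A B t (dl^-1 *: (x - x0)) (v' i).
  move=> /andP[t0 tt].
  rewrite (eq_trajectory A B x (controls_vlocb cU (Uv i)) (continuous_vlocb (cv i))); last first.
    by move=> s s0 st; rewrite /v (ltW s0) (le_trans st tt).
  rewrite -(trajectoryZ A B dl t _ (bv i)) scalerA mulfV ?gt_eqF // scale1r.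
  have := trajectoryD A B t x0 (x - x0) (vlocb_cst w0) (vlocbZ dl (bv i)).
  by rewrite (trajectory_equilibrium t0 eq0) addrCA subrr addr0.
split.
- exact: Uv.
- by move=> i t; rewrite /v; case: ifP => // /(inU i) [].
- move=> x x1; have [y /(nthP 0) [n nY yE] hy] := HY _ x1.
  pose i := Ordinal nY; exists i; last first.
    move=> t tt; rewrite trE //; apply: HD; rewrite opprD addrA subrr sub0r normrN normrZ.
    by rewrite (ger0_norm (ltW dl0)); exact/dlD/HC.
  rewrite trE ?lexx ?(ltW tau0) // addrC addKr scalerA mulVf ?gt_eqF // scale1r.
  have := trajectory_sub A B tau (dl^-1 *: (x - x0)) 0 (v' i).
  rewrite (Hv' i).2 opprK subr0 /= yE => /(canRL (addrK _)) ->.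
  exact: hy.
- exists (dl / (c1 + 1)); first by rewrite divr_gt0 // ltr_wpDl.
  move=> x xr; apply: (@cboxW _ _ (c1 * `|dl^-1 *: (x - x0)|)); last first.
    by apply: Hc1 => //; exact: cbox_cvec.
  rewrite normrZ (ger0_norm (ltW _)) ?invr_gt0 // distrC mulrCA ler_pdivrMl // mulr1.
  have c11 : 0 < c1 + 1 by rewrite ltr_wpDl.
  move: xr; rewrite ltr_pdivlMr // => /ltW; apply: le_trans.
  by rewrite mulrC ler_wpM2l // lerDl.
Qed.

End LocalControls.

(** * Concatenating local controls *)

Section Words.
Context {R : realType} {d m : nat}.
Variables (A : 'M[R]_d) (B : 'M[R]_(d, m)) (U : set 'cV[R]_m).
Hypothesis cU : compact U.
Variables (D : set 'cV[R]_d) (f : 'cV[R]_m -> R) (w0 : 'cV[R]_m).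
Hypothesis Uw0 : U w0.
Variables (N : nat) (v : 'I_N -> R -> 'cV[R]_m) (K1 : set 'cV[R]_d) (tau : R) (b : R).
Hypothesis tau0 : 0 < tau.
Hypothesis Uv : forall i, controls U (v i).
Hypothesis fw0 : f w0 <= b.
Hypothesis fv : forall i t, f (v i t) <= b.
Hypothesis step : forall x, K1 x -> exists2 i, K1 (trajectory A B tau x (v i)) &
  forall t, 0 <= t <= tau -> D (trajectory A B t x (v i)).

(** After the last letter the control rests at [w0], so that it stays in [U] and obeys the bound [b]
    at all later times. *)
Definition word (s : seq 'I_N) : R -> 'cV[R]_m :=
  foldr (fun i w => concat tau (v i) w) (fun=> w0) s.

Lemma controls_word s : controls U (word s).
Proof.
by elim: s => [|i s IH]; [exact: controls_cst|exact: controls_concat].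
Qed.

Lemma word_le s t : f (word s t) <= b.
Proof. by elim: s t => [|i s IH] t //=; rewrite /concat; case: ifP. Qed.

Lemma word_steers n x : K1 x -> exists s : n.-tuple 'I_N,
  forall t, 0 <= t <= n%:R * tau -> D (trajectory A B t x (word s)).
Proof.
elim: n x => [|n IH] x K1x.
  (* Only time 0 is left, and [K1] lies in [D] by [step] at time 0. *)
  exists [tuple] => t; rewrite mul0r -eq_le => /eqP <-; rewrite trajectory0.
  have [i _ h] := step K1x.
  by have := h 0; rewrite trajectory0 lexx ltW //; exact.
have [i K1i Di] := step K1x; have [s hs] := IH _ K1i.
exists [tuple of i :: s] => t /andP[t0 tn] /=.
have bi := controls_vlocb cU (Uv i); have bs := controls_vlocb cU (controls_word s).
have [tt|/ltW tt] := leP t tau.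
  by rewrite (trajectory_concat_le A B x bi bs tt); apply: Di; rewrite t0.
have tt0 : 0 <= t - tau by rewrite subr_ge0.
have -> : t = tau + (t - tau) by rewrite addrC subrK.
rewrite (trajectory_concat_ge A B x bi bs (ltW tau0) tt0); apply: hs.
by rewrite tt0 lerBlDr -[X in _ + X]mul1r -mulrDl natr1.
Qed.

End Words.

(** * Steering a compact set by finitely many controls *)

Section Steering.
Context {R : realType} {d m : nat}.
Variables (A : 'M[R]_d) (B : 'M[R]_(d, m)) (U : set 'cV[R]_m).
Hypothesis cU : compact U.
Variables (D : set 'cV[R]_d) (x0 : 'cV[R]_d).
Hypothesis DD : control_set A B U D.
Hypothesis Dx0 : D x0.

(** From each point of [K] some control reaches the ball around [x0], and it does so from nearby
    points too; compactness leaves finitely many. The arcs remain in [D] by [control_set_arc], as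
    both ends lie there. *)
Lemma steering (K K1 : set 'cV[R]_d) (r : R) : compact K -> K `<=` D -> 0 < r ->
  (forall x, `|x0 - x| < r -> K1 x) -> K1 `<=` D ->
  exists L (t : 'I_L -> R) (w : 'I_L -> R -> 'cV[R]_m),
  [/\ forall j, 0 < t j, forall j, controls U (w j) &
    forall x, K x -> exists2 j, K1 (trajectory A B (t j) x (w j)) &
      forall s, 0 <= s <= t j -> D (trajectory A B s x (w j))].
Proof.
move=> cK KD r0 HK1 K1D.
have r2 : 0 < r / 2 by rewrite divr_gt0.
have H (x : 'cV[R]_d) : exists q : R * (R -> 'cV[R]_m) * R, K x ->
    [/\ 0 < q.1.1, controls U q.1.2, 0 < q.2 &
     forall y, `|x - y| < q.2 -> K1 (trajectory A B q.1.1 y q.1.2)].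
  have [Kx|nKx] := pselect (K x); last by exists (0, fun=> 0, 0).
  have /closure_normP /(_ _ r2) [y [t [w [t0 Uw yE]]] xy] := DD.1.2 _ (KD _ Kx) _ Dx0.
  have [p p0 Hp] := trajectory_close A B t x w r2.
  exists (t, w, p) => _; split => // z /Hp zy; apply: HK1.
  have -> : x0 - trajectory A B t z w = (x0 - y) + (trajectory A B t x w - trajectory A B t z w).
    by rewrite yE addrA subrK.
  by rewrite (splitr r) (le_lt_trans (ler_normD _ _)) // ltrD.
have [q Hq] := choice H.
have : cover_compact K by rewrite -compact_cover.
move=> /(_ _ K (fun x => ball x (q x).2)) [|y Ky|F FK KF].
- by move=> x Kx; apply: ball_open; have [] := Hq _ Kx.
- by exists y => //; apply: ballxx; have [] := Hq _ Ky.
pose s : seq 'cV[R]_d := finmap.enum_fset F.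
have sK (j : 'I_(size s)) : K s`_j.
  by apply/set_mem/FK; exact: (mem_nth 0 (ltn_ord j)).
exists (size s), (fun j => (q s`_j).1.1), (fun j => (q s`_j).1.2).
split => [j|j|x Kx]; [by have [] := Hq _ (sK j)|by have [] := Hq _ (sK j)|].
have [y /= yF xy] := KF _ Kx.
have ys : (index y s < size s)%N by rewrite index_mem.
pose j := Ordinal ys; have jE : s`_j = y by exact: nth_index.
have [q1 q2 _ q4] := Hq _ (sK j).
have K1x : K1 (trajectory A B (q s`_j).1.1 x (q s`_j).1.2).
  by apply: q4; rewrite jE; move: xy; rewrite -ball_normE.
exists j => // t tt.
apply: (control_set_arc cU DD (KD _ Kx) q2 (ltW q1) (K1D _ K1x) tt).
Qed.

End Steering.

(** * Costs of controls and sums over finite families *)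

Section SpanningBound.
Context {R : realType} {d m : nat}.
Variables (A : 'M[R]_d) (B : 'M[R]_(d, m)) (U : set 'cV[R]_m).
Hypothesis cU : compact U.
Variable f : 'cV[R]_m -> R.
Hypothesis cf : {within U, continuous f}.
Local Notation mu := (@lebesgue_measure R).

Lemma locb_cost w : controls U w -> locb (f \o w).
Proof.
move=> [mw Uw]; split.
  apply: borel_control_comp => // O oO.
  have /continuousP cfO := cf; have /open_subspaceP [V oV VE] := cfO O oO.
  exists V => //; apply/seteqP; split => s /= h.
    have : (f @^-1` O `&` U) (w s) by split => //; exact: Uw.
    by rewrite -VE => -[].
  have : (V `&` U) (w s) by split => //; exact: Uw.
  by rewrite VE => -[].
have [M [_ HM]] := compact_bounded (continuous_compact cf cU).
move=> T; exists (M + 1) => s _; apply: (HM (M + 1)); first by rewrite ltrDl.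
by exists (w s) => //; exact: Uw.
Qed.

Lemma potential_sum_ge a tau w : controls U w -> 0 <= tau -> (forall t, a <= f (w t)) ->
  a * tau <= potential_sum tau f w.
Proof.
move=> Uw tau0 fa; have bw := locb_cost Uw.
have -> : a * tau = \int[mu]_(t in `[0, tau]) a.
  rewrite Rintegral_cst //= lebesgue_measure_itv /= lte_fin.
  by case: ltgtP tau0 => // [_|<-]; rewrite ?sube0 //= ?mulr0.
by apply: le_Rintegral => //; [exact: (locb_integrable _ _ (locb_cst a))|exact: locb_integrable bw].
Qed.

Lemma Rintegral_le_cst g (a b c : R) : locb g -> a <= b ->
  (forall t, a < t -> t <= b -> g t <= c) -> \int[mu]_(t in `[a, b]) g t <= c * (b - a).
Proof.
move=> bg ab gc.
have -> : c * (b - a) = \int[mu]_(t in `]a, b]) c.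
  rewrite Rintegral_cst //= lebesgue_measure_itv /= lte_fin.
  by case: ltgtP ab => // -> _; rewrite subrr.
have sub : (`]a, b]%classic : set R) `<=` `[a, b]%classic by apply: subset_itvr; rewrite bnd_simp.
rewrite -Rintegral_itv_obnd_cbnd; last by apply: integrableS (locb_integrable a b bg).
apply: le_Rintegral => //.
- by apply: integrableS (locb_integrable a b bg).
- by apply: integrableS (locb_integrable a b (locb_cst c)).
- by move=> t /=; rewrite in_itv /= => /andP[t1 t2]; exact: gc.
Qed.

Lemma potential_sum_le (T tau F b : R) w : controls U w -> 0 <= T -> T <= tau ->
  (forall u, U u -> f u <= F) -> (forall t, T < t -> f (w t) <= b) ->
  potential_sum tau f w <= F * T + b * (tau - T).
Proof.
move=> Uw T0 Ttau fF fb; have bw := locb_cost Uw.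
rewrite /potential_sum (Rintegral_split bw T0 Ttau); apply: lerD.
  rewrite -[X in F * X]subr0; apply: Rintegral_le_cst => // t _ _.
  by apply: fF; exact: Uw.2.
by apply: Rintegral_le_cst => // t tT _; exact: fb.
Qed.

(** Several indices may give the same control, which the sum over the range counts once; hence an
    inequality, by way of the duplicate-free list [r]. *)
Lemma esum_range_le (I : finType) (g : I -> R -> 'cV[R]_m) (a : (R -> 'cV[R]_m) -> R) (b : R) :
  (forall w, 0 <= a w) -> (forall i, a (g i) <= b) -> 0 <= b ->
  (\esum_(w in range g) (a w)%:E <= (#|I|%:R * b)%:E)%E.
Proof.
move=> a0 gb b0; pose r := undup [seq g i | i <- enum I].
have -> : range g = [set` r].
  apply/seteqP; split => w /=; rewrite mem_undup.
    by move=> [i _ <-]; apply: map_f; rewrite mem_enum.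
  by move=> /mapP [i _ ->]; exists i.
rewrite esum_fset; [|exact: finite_seq|by move=> w _; rewrite lee_fin].
rewrite -fsbig_seq ?undup_uniq // sumEFin lee_fin.
apply: (@le_trans _ _ (\sum_(w <- r) b)).
  rewrite big_seq [leRHS]big_seq; apply: ler_sum => w; rewrite mem_undup.
  by move=> /mapP [i _ ->].
rewrite big_const_seq count_predT iter_addr addr0 -[leLHS]mulr_natl ler_wpM2r // ler_nat.
by rewrite (leq_trans (size_undup _)) // size_map -cardE.
Qed.

End SpanningBound.

Section UpperBound.
Context {R : realType} {d m : nat}.
Variables (A : 'M[R]_d) (B : 'M[R]_(d, m)) (U : set 'cV[R]_m).
Variables (D : set 'cV[R]_d) (f : 'cV[R]_m -> R) (w0 : 'cV[R]_m) (x0 : 'cV[R]_d).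
Hypothesis cU : compact U.
Hypothesis cAB : controllable A B.
Hypothesis DD : control_set A B U D.
Hypothesis cf : {within U, continuous f}.
Hypothesis Uw0 : U° w0.
Hypothesis Dx0 : D° x0.
Hypothesis eq0 : A *m x0 + B *m w0 = 0.
Variable K : set 'cV[R]_d.
Hypothesis cK : compact K.
Hypothesis KD : K `<=` D.
Variable P : 'M[R[i]]_d.
Hypothesis Pu : P \in unitmx.
Hypothesis hT : is_trig_mx (conj_cplx P A).
Let h := \sum_j Num.max 0 (complex.Re (conj_cplx P A j j)).

(** The spanning set consists of a steering control into [K1] followed by a word of [n] local
    controls. These are at most [L * N ^ n] controls, each costing at most [F] per unit of time up
    to [Tm] and [b] afterwards. *)
Lemma inv_pressure_at_le e : 0 < e -> exists c T0 : R, forall tau, T0 <= tau ->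
  (inv_pressure_at A B U tau f K D <= (expR ((h + f w0 + e) * tau + c))%:E)%E.
Proof.
move=> e0; have e2 : 0 < e / 2 by rewrite divr_gt0.
have h0 : 0 <= h by rewrite sumr_ge0 // => j _; rewrite le_max lexx.
have [sg [P' [Y [sg0 P'u sY HY]]]] := efficient_cover Pu hT e2.
have [v [K1 [Uv fv step [r r0 Hr]]]] := local_controls cU cAB cf Uw0 Dx0 eq0 sg0 P'u e2 HY.
have Uw : U w0 by exact: interior_subset.
have Dx : D x0 by exact: interior_subset.
have K1D : K1 `<=` D.
  move=> x /step [i _ Di]; have := Di 0; rewrite trajectory0 lexx ltW //; exact.
have [L [t [w [t0 Uw' Hw]]]] := steering cU DD Dx cK KD r0 Hr K1D.
have [M [_ HM]] := compact_bounded (continuous_compact cf cU).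
pose F := M + 1.
have fF u : U u -> f u <= F.
  move=> Uu; apply: (le_trans (ler_norm _)); apply: (HM F); first by rewrite ltrDl.
  by exists u.
pose N := size Y; pose b := f w0 + e / 2.
have fb : f w0 <= b by rewrite lerDl ltW.
pose Tm := \sum_j t j.
have Tm0 : 0 <= Tm by rewrite sumr_ge0 // => j _; exact: ltW.
have tTm j : t j <= Tm by rewrite /Tm (bigD1 j) //= lerDl sumr_ge0 // => k _; exact: ltW.
(* All terms of the exponent that do not grow with [tau]; the number [L] of steering controls is
   replaced by the larger exp(L). *)
pose c := L%:R + (h + e / 2) * sg + F * Tm - b * Tm.
exists c, Tm => tau Ttau.
have tau0 : 0 <= tau by exact: le_trans Ttau.
(* The letters alone last for at least [tau] and at most [tau + sg]. *)
pose n := (Num.truncn (tau / sg)).+1.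
have q0 : 0 <= tau / sg by rewrite divr_ge0 // ltW.
have /andP[n1 n2] := truncn_itv q0.
have ntau : tau <= n%:R * sg by rewrite -ler_pdivrMr // ltW.
have ntau' : n%:R * sg <= tau + sg.
  by rewrite /n -natr1 mulrDl mul1r lerD2r -ler_pdivlMr.
pose g (p : 'I_L * n.-tuple 'I_N) := concat (t p.1) (w p.1) (word w0 v sg p.2).
have Uword s : controls U (word w0 v sg s) by exact: controls_word.
have Ug p : controls U (g p) by apply: controls_concat.
have Sspan : spanning A B U tau K D (range g).
  split=> [_ [p _ <-]|x Kx]; first exact: Ug.
  have [j K1j Dj] := Hw x Kx.
  have [s Hs] := word_steers cU Uw sg0 Uv step n K1j.
  exists (g (j, s)); first by exists (j, s).
  move=> s' /andP[s0 st]; rewrite /g /=.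
  have bw := controls_vlocb cU (Uw' j); have bs := controls_vlocb cU (Uword s).
  have [st'|/ltW st'] := leP s' (t j).
    by rewrite (trajectory_concat_le A B x bw bs st'); apply: Dj; rewrite s0.
  have st0 : 0 <= s' - t j by rewrite subr_ge0.
  have -> : s' = t j + (s' - t j) by rewrite addrC subrK.
  rewrite (trajectory_concat_ge A B x bw bs (ltW (t0 j)) st0); apply: Hs.
  rewrite st0 /= lerBlDr (le_trans st) // (le_trans ntau) // lerDl; exact: ltW.
have psum p : potential_sum tau f (g p) <= F * Tm + b * (tau - Tm).
  apply: (potential_sum_le cU cf (Ug p)) => // t' Tt'.
  rewrite /g /concat ifF; first exact: word_le.
  by apply/negbTE; rewrite -ltNge (le_lt_trans (tTm p.1)).
apply: (@le_trans _ _ (\esum_(w in range g) (expR (potential_sum tau f w))%:E)%E).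
  by apply: ereal_inf_lbound; exists (range g).
apply: (le_trans (esum_range_le (a := fun w => expR (potential_sum tau f w))
  (b := expR (F * Tm + b * (tau - Tm))) _ _ _)).
- by move=> w'; exact: expR_ge0.
- by move=> p; rewrite ler_expR.
- exact: expR_ge0.
rewrite lee_fin card_prod card_ord card_tuple card_ord natrM natrX.
have sYn : N%:R ^+ n <= expR ((h + e / 2) * (tau + sg)) :> R.
  apply: (@le_trans _ _ (expR (sg * (h + e / 2)) ^+ n)).
    by apply: lerXn2r; rewrite ?nnegrE ?expR_ge0.
  rewrite -expRM_natl ler_expR mulrA mulrC ler_wpM2l //.
  by rewrite addr_ge0 // ltW.
have LL : L%:R <= expR L%:R :> R by apply: le_trans (expR_ge1Dx _); rewrite lerDr.
apply: (@le_trans _ _ (expR L%:R * expR ((h + e / 2) * (tau + sg)) *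
  expR (F * Tm + b * (tau - Tm)))).
  by rewrite ler_wpM2r ?expR_ge0 // ler_pM.
rewrite -!expRD ler_expR /c /b.
have fin (l h' e' s F' T t' w' : R) :
   l + (h' + e' / 2) * (t' + s) + (F' * T + (w' + e' / 2) * (t' - T)) =
   (h' + w' + e') * t' + (l + (h' + e' / 2) * s + F' * T - (w' + e' / 2) * T) by field.
by rewrite fin.
Qed.

Lemma inv_pressure_le : (inv_pressure A B U f K D <= (h + f w0)%:E)%E.
Proof.
apply/lee_addgt0Pr => e e0; rewrite -EFinD.
have e2 : 0 < e / 2 by rewrite divr_gt0.
have [c [T0 H]] := inv_pressure_at_le e2.
(* Beyond [T] the constant contributes c / tau <= e / 2, the other half of [e]. *)
pose T := Num.max 1 (Num.max T0 (2 * `|c| / e)).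
rewrite /inv_pressure /limf_esup.
pose F tau : \bar R := ((tau^-1)%:E * lne (inv_pressure_at A B U tau f K D))%E.
apply: (@le_trans _ _ (ereal_sup (F @` [set tau | T < tau]))).
  apply: ereal_inf_lbound; exists [set tau | T < tau] => //.
  by exists T; split => //; exact: num_real.
apply: ge_ereal_sup => _ [tau /= Ttau <-]; rewrite /F.
move: Ttau; rewrite !gt_max => /andP[t1 /andP[tT0 tc]].
have tau0 : 0 < tau by exact: lt_trans t1.
have le1 : (lne (inv_pressure_at A B U tau f K D) <= ((h + f w0 + e / 2) * tau + c)%:E)%E.
  apply: (@le_trans _ _ (lne (expR ((h + f w0 + e / 2) * tau + c))%:E)).
    rewrite lee_lne; first exact: H (ltW tT0).
    - rewrite in_itv /= leey andbT; apply: le_ereal_inf_tmp => _ [S _ <-].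
      by apply: esum_ge0 => w _; rewrite lee_fin expR_ge0.
    - by rewrite in_itv /= leey andbT lee_fin expR_ge0.
  by rewrite lne_EFin ?expR_gt0 // expRK.
apply: (@le_trans _ _ ((tau^-1)%:E * ((h + f w0 + e / 2) * tau + c)%:E)%E).
  by apply: lee_wpmul2l => //; rewrite lee_fin invr_ge0 ltW.
rewrite -EFinM lee_fin ler_pdivrMl // [leRHS]mulrC.
rewrite (_ : (h + f w0 + e) * tau = (h + f w0 + e / 2) * tau + e / 2 * tau); last by field.
rewrite lerD2l (le_trans (ler_norm c)) //.
move: tc; rewrite ltr_pdivrMr // => /ltW tc.
rewrite mulrAC ler_pdivlMr // mulrC; apply: (le_trans tc); by rewrite mulrC.
Qed.

End UpperBound.

(** * Lower bound *)

Section LowerBound.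
Context {R : realType} {d m : nat}.
Variables (A : 'M[R]_d) (B : 'M[R]_(d, m)) (U : set 'cV[R]_m).
Variables (D : set 'cV[R]_d) (f : 'cV[R]_m -> R) (w0 : 'cV[R]_m).
Hypothesis cU : compact U.
Hypothesis cf : {within U, continuous f}.
Hypothesis fmin : forall u, U u -> f w0 <= f u.
Variable CD : R.
Hypothesis CD0 : 0 <= CD.
Hypothesis DCD : forall x, D x -> `|x| <= CD.
Variable K : set 'cV[R]_d.
Variables (xK : 'cV[R]_d) (rK : R).
Hypothesis rK0 : 0 < rK.
Hypothesis HK : forall x, `|xK - x| < rK -> K x.
Variable P : 'M[R[i]]_d.
Hypothesis Pu : P \in unitmx.
Hypothesis hT : is_trig_mx (conj_cplx P A).
Let h := \sum_j Num.max 0 (complex.Re (conj_cplx P A j j)).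

(* A grid whose points are pushed apart by [expmx (tau *: A)] beyond the diameter
   of [D]: two grid points cannot share the controls steering their real and
   imaginary parts, so that [#|grid|] is at most the square of the number of controls. *)
Lemma spanning_size : exists2 c : R, 0 < c & forall tau S, 0 < tau ->
  spanning A B U tau K D S -> exists2 r : seq (R -> 'cV[R]_m),
    uniq r /\ (forall w, w \in r -> S w) & c * expR (tau * h) <= (size r)%:R.
Proof.
have [c1 c10 H1] := cbox_mulmx P; have [c2 c20 H2] := cbox_mulmx (invmx P).
(* Real and imaginary parts of grid coordinates go up to [dl], and [invmx P] enlarges a polydisc by
   a factor of at most [c2], so the real points made from the grid stay within [rK] of [xK]. *)
pose dl := rK / (2 * (c2 + 1)).
have c21 : 0 < c2 + 1 by rewrite ltr_wpDl.
have dl0 : 0 < dl by rewrite divr_gt0 // mulr_gt0.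
have dlK : c2 * (dl + dl) < rK.
  have -> : c2 * (dl + dl) = rK * (c2 / (c2 + 1)) by rewrite /dl; field; rewrite gt_eqF.
  by rewrite gtr_pMr // ltr_pdivrMr // mul1r ltrDl.
(* Two points of [D] differ by at most [CD + CD], and [P] maps a complex vector with such real and
   imaginary parts below [C]; the 1 makes this strict. *)
pose C := c1 * (CD + CD) + c1 * (CD + CD) + 1.
have C'0 : 0 <= c1 * (CD + CD) + c1 * (CD + CD) by repeat (apply: addr_ge0 || apply: mulr_ge0).
have C0 : 0 < C by rewrite ltr_wpDl.
(* Chosen so that [n j] below is at least c0 max(1, mu_j). *)
pose c0 := Num.min 1 (dl / C).
have c00 : 0 < c0 by rewrite lt_min ltr01 divr_gt0.
exists (c0 ^+ d); first exact: exprn_gt0.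
move=> tau S tau0 [SU HS].
pose M := conj_cplx P (expmx (tau *: A)).
have hM : is_trig_mx M := conj_expmx_trig Pu hT tau.
pose mu j := normc (M j j).
have muE j : mu j = expR (tau * complex.Re (conj_cplx P A j j)) := conj_expmx_diag Pu hT tau j.
have mu0 j : 0 < mu j by rewrite muE expR_gt0.
(* The mesh in coordinate [j]: the diagonal entry stretches one step to length [C]. *)
pose s j := C / mu j.
have s0 j : 0 < s j by rewrite divr_gt0.
pose n j := (Num.truncn (dl / s j)).+1.
pose T := {ffun 'I_d -> 'I_(grid_bound n) * 'I_(grid_bound n)}.
pose z (k : T) : 'cV[R[i]]_d :=
  \col_j Complex (s j * ((k j).1 : nat)%:R) (s j * ((k j).2 : nat)%:R).
have nle j (a : nat) : (a < n j)%N -> `|s j * a%:R| <= dl.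
  rewrite ltnS => an; have sa0 : 0 <= s j * a%:R by apply: mulr_ge0 => //; exact: ltW.
  rewrite (ger0_norm sa0) mulrC -ler_pdivlMr //.
  have q0 : 0 <= dl / s j by rewrite divr_ge0 // ltW.
  by have /andP[h1 _] := truncn_itv q0; apply: le_trans h1; rewrite ler_nat.
have zb (k : T) : k \in grid n -> cbox (dl + dl) (z k).
  move=> /familyP kg j; have := kg j; rewrite !inE => /andP[k1 k2].
  by rewrite mxE (le_trans (normc_ReIm _)) //= lerD // nle.
have /choice [X HX] (k : T) : exists p : 'cV[R]_d * 'cV[R]_d,
    invmx P *m z k = cvec p.1 + 'i%C *: cvec p.2.
  by have [x [y E]] := cvec_split (invmx P *m z k); exists (x, y).
have inK (k : T) : k \in grid n -> K (xK + (X k).1) /\ K (xK + (X k).2).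
  move=> kg; have dd : 0 <= dl + dl by rewrite addr_ge0 // ltW.
  have := H2 _ _ dd (zb k kg); rewrite HX => /cvec_le [|h1 h2].
    by rewrite mulr_ge0.
  by split; apply: HK; rewrite opprD addrA subrr sub0r normrN; apply: le_lt_trans dlK.
have /choice [W HW] (k : T) : exists p : (R -> 'cV[R]_m) * (R -> 'cV[R]_m), k \in grid n ->
    [/\ S p.1, S p.2, D (trajectory A B tau (xK + (X k).1) p.1) &
     D (trajectory A B tau (xK + (X k).2) p.2)].
  have [kg|nkg] := boolP (k \in grid n); last by exists (fun=> 0, fun=> 0).
  have [K1 K2] := inK k kg.
  have [w1 Sw1 Hw1] := HS _ K1; have [w2 Sw2 Hw2] := HS _ K2.
  by exists (w1, w2) => _; split => //; [apply: Hw1|apply: Hw2]; rewrite lexx ltW.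
have Winj : {in grid n &, injective W}.
  (* If two grid points share both controls, their images differ by less than [C], whereas the first
     coordinate in which the grid points differ is stretched to at least [C]. *)
  move=> k k' kg kg' WE; apply/eqP; apply: contraT => kk'.
  have [_ _ h1 h2] := HW k kg; have [_ _ h3 h4] := HW k' kg'.
  rewrite WE in h1 h2.
  have diff (x y y' : 'cV[R]_d) w : D (trajectory A B tau (x + y) w) ->
      D (trajectory A B tau (x + y') w) -> `|expmx (tau *: A) *m (y - y')| <= CD + CD.
    move=> /DCD a1 /DCD a2.
    have -> : y - y' = (x + y) - (x + y') by rewrite opprD addrACA subrr add0r.
    by rewrite -(trajectory_sub A B tau _ _ w) (le_trans (ler_normB _ _)) // lerD.
  have d1 := diff _ _ _ _ h1 h3; have d2 := diff _ _ _ _ h2 h4.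
  have zE : M *m (z k - z k') = P *m cvec (expmx (tau *: A) *m ((X k).1 - (X k').1)) +
      'i%C *: (P *m cvec (expmx (tau *: A) *m ((X k).2 - (X k').2))).
    have -> : z k - z k' = P *m (cvec ((X k).1 - (X k').1) + 'i%C *: cvec ((X k).2 - (X k').2)).
      rewrite !cvecB scalerBr addrACA -opprD -!HX -mulmxBr mulKVmx //.
    have := conj_cplx_expr (expmx (tau *: A)) 1
      (cvec ((X k).1 - (X k').1) + 'i%C *: cvec ((X k).2 - (X k').2)) Pu.
    by rewrite !expr1 complexify_mul_cvec => ->; rewrite mulmxDr -scalemxAr.
  have CDD : 0 <= CD + CD by rewrite addr_ge0.
  have zbox : cbox (c1 * (CD + CD) + c1 * (CD + CD)) (M *m (z k - z k')).
    rewrite zE; apply: cboxD; first by apply: H1 => //; exact: cboxW d1 (cbox_cvec _).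
    have -> : c1 * (CD + CD) = normc ('i%C : R[i]) * (c1 * (CD + CD)).
      by rewrite /normc /= expr0n expr1n add0r sqrtr1 mul1r.
    by apply: cboxZ; apply: H1 => //; exact: cboxW d2 (cbox_cvec _).
  have z0 : z k - z k' != 0.
    apply: contra kk'; rewrite subr_eq0 => /eqP zz; apply/eqP/ffunP => j.
    have /colP /(_ j) := zz; rewrite !mxE => -[e1 e2].
    move: e1 e2; case: (k j) => a b; case: (k' j) => a' b' /=.
    move=> /(mulfI (lt0r_neq0 (s0 j))) /eqP + /(mulfI (lt0r_neq0 (s0 j))) /eqP.
    by rewrite !eqr_nat => /eqP/val_inj -> /eqP/val_inj ->.
  have [j zj Mzj] := trig_separated hM z0.
  have := zbox j; rewrite Mzj normcM -/(mu j).
  have sj : s j <= normc ((z k - z k') j 0).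
    have nd (a b : nat) : a != b -> s j <= `|s j * a%:R - s j * b%:R|.
      move=> ab; rewrite -mulrBr normrM gtr0_norm // ler_peMr ?(ltW (s0 j)) //.
      wlog lt_ab : a b ab / (b < a)%N.
        move=> H; move: (ab); rewrite neq_ltn => /orP [lt|]; last exact: H.
        by rewrite distrC; apply: H => //; rewrite eq_sym.
      by rewrite -natrB ?(ltnW lt_ab) // normr_nat ler1n subn_gt0.
    move: zj; rewrite !mxE; case: (k j) => a b; case: (k' j) => a' b' /= ne.
    have [ab|ab] := eqVneq (a : nat) a'; last exact: le_trans (nd _ _ ab) (normc_Re (Complex _ _)).
    have [bb|bb] := eqVneq (b : nat) b'; last exact: le_trans (nd _ _ bb) (normc_Im (Complex _ _)).
    by move: ne; rewrite ab bb eq_complex /= !subrr eqxx.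
  have : C <= mu j * normc ((z k - z k') j 0).
    rewrite -ler_pdivrMl // mulrC; exact: sj.
  by move=> c3 /(le_trans c3); rewrite /C gerDl ler10.
(* The pairs [W k] are distinct on the grid and have both components in [r]; taking roots of the
   resulting inequality removes the squares in [card_grid]. *)
pose r := undup ([seq (W k).1 | k <- enum (grid n)] ++ [seq (W k).2 | k <- enum (grid n)]).
exists r.
  split; first exact: undup_uniq.
  move=> w; rewrite mem_undup mem_cat => /orP [] /mapP [k];
    by rewrite mem_enum => /HW [] => *; subst w.
have sz : (\prod_j n j <= size r)%N.
  have sqE : ((\prod_j n j) ^ 2 = \prod_j n j ^ 2)%N.
    by rewrite -mulnn -big_split; apply: eq_bigr => j _; exact: mulnn.
  rewrite -leq_sqr sqE -card_grid.
  have -> : #|grid n| = size [seq W k | k <- enum (grid n)] by rewrite size_map -cardE.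
  have -> : (size r ^ 2 = size [seq (a, b) | a <- r, b <- r])%N by rewrite size_allpairs mulnn.
  apply: uniq_leq_size.
    rewrite map_inj_in_uniq ?enum_uniq // => k k'; rewrite !mem_enum; exact: Winj.
  move=> p /mapP [k kg ->]; apply/allpairsP; exists (W k); split.
  - by rewrite mem_undup mem_cat (map_f (fun k => (W k).1) kg).
  - by rewrite mem_undup mem_cat (map_f (fun k => (W k).2) kg) orbT.
  - by case: (W k).
apply: (@le_trans _ _ (\prod_j n j)%N%:R); last by rewrite ler_nat.
have -> : c0 ^+ d * expR (tau * h) = \prod_j (c0 * Num.max 1 (mu j)).
  rewrite big_split /= prodr_const card_ord; congr (_ * _).
  rewrite /h mulr_sumr expR_sum; apply: eq_bigr => j _.
  rewrite muE; set l := complex.Re _.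
  have [l0|l0] := leP 0 l.
    by rewrite max_r // -[X in X <= _]expR0 ler_expR mulr_ge0 // ltW.
  by rewrite mulr0 expR0 max_l // -[leRHS]expR0 ler_expR pmulr_rle0 // ltW.
rewrite natr_prod; apply: ler_prod => j _.
have m1 : 0 <= Num.max 1 (mu j) by rewrite le_max ler01.
rewrite mulr_ge0 ?(ltW c00) //=.
have c01 : c0 <= 1 by rewrite ge_min lexx.
have c0C : c0 <= dl / C by rewrite ge_min lexx orbT.
have [mu1|mu1] := leP (mu j) 1.
  by rewrite mulr1 (le_trans c01) // /n ler1n.
apply: (@le_trans _ _ (dl / s j)); last by rewrite ltW // truncnS_gt.
by rewrite /s invf_div mulrA mulrAC ler_wpM2r // ltW.
Qed.

Lemma inv_pressure_at_ge : exists2 c : R, 0 < c & forall tau, 0 < tau ->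
  ((c * expR (tau * (h + f w0)))%:E <= inv_pressure_at A B U tau f K D)%E.
Proof.
have [c c0 Hc] := spanning_size; exists c => // tau tau0.
apply: le_ereal_inf_tmp => _ [S Sspan <-].
have [r [ur rS] hr] := Hc tau S tau0 Sspan.
apply: esum_ge; exists [set` r].
  by split; [exact: finite_seq|move=> w /= /rS].
rewrite -fsbig_seq // sumEFin lee_fin.
apply: (@le_trans _ _ (\sum_(w <- r) expR (f w0 * tau))).
  rewrite big_const_seq count_predT iter_addr addr0 -[leRHS]mulr_natl.
  by rewrite mulrDr expRD mulrA (mulrC tau (f w0)) ler_wpM2r // expR_ge0.
rewrite big_seq [leRHS]big_seq; apply: ler_sum => w /rS Sw; rewrite ler_expR.
have Uw := Sspan.1 _ Sw.
apply: (potential_sum_ge cU cf Uw (ltW tau0)) => t; apply: fmin; exact: Uw.2.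
Qed.

Lemma inv_pressure_ge : ((h + f w0)%:E <= inv_pressure A B U f K D)%E.
Proof.
have [c c0 Hc] := inv_pressure_at_ge.
apply: le_ereal_inf_tmp => _ [V [T [_ HV]] <-].
apply/lee_subgt0Pr => e e0; rewrite -EFinB.
(* The first entry puts [tau] into the given neighbourhood of infinity; the last makes ln(c) / tau
   at least -e. *)
pose tau := Num.max (T + 1) (Num.max 1 (`|ln c| / e)).
have tau1 : 1 <= tau by rewrite /tau !le_max lexx orbT.
have tau0 : 0 < tau by exact: lt_le_trans tau1.
have Vtau : V tau by apply: HV; rewrite /tau lt_max ltrDl ltr01.
apply: (@le_trans _ _ ((tau^-1)%:E * lne (inv_pressure_at A B U tau f K D))%E); last first.
  by apply: ereal_sup_ubound; exists tau.
apply: (@le_trans _ _ ((tau^-1)%:E * (ln c + tau * (h + f w0))%:E)%E).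
  rewrite -EFinM lee_fin ler_pdivlMl // mulrC mulrBl mulrC addrC lerD2r.
  have : `|ln c| / e <= tau by rewrite /tau !le_max lexx !orbT.
  rewrite ler_pdivrMr // => hc.
  by rewrite lerNl (le_trans (ler_norm _)) // normrN (le_trans hc) // mulrC.
apply: lee_wpmul2l; first by rewrite lee_fin invr_ge0 ltW.
have p0 : 0 < c * expR (tau * (h + f w0)) by rewrite mulr_gt0 // expR_gt0.
have -> : (ln c + tau * (h + f w0))%:E = lne (c * expR (tau * (h + f w0)))%:E.
  by rewrite lne_EFin // lnM ?posrE ?expR_gt0 // expRK.
rewrite lee_lne; first exact: Hc.
- by rewrite in_itv /= leey andbT lee_fin ltW.
- rewrite in_itv /= leey andbT; apply: le_trans (Hc tau tau0).
  by rewrite lee_fin ltW.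
Qed.

End LowerBound.

(** * Admissibility and the pressure formula *)

Unset Implicit Arguments.

Theorem corollary6p4 (R : realType) (d m : nat)
    (A : 'M[R]_d) (B : 'M[R]_(d, m)) (U : set 'cV[R]_m)
    (D : set 'cV[R]_d) (f : 'cV[R]_m -> R)
    (w0 : 'cV[R]_m) (x0 : 'cV[R]_d) :
  controllable A B ->
  hyperbolic A ->
  compact U -> nbhs (0 : 'cV[R]_m) U ->
  control_set A B U D -> D° !=set0 ->
  {within U, continuous f} ->
  U° w0 -> (forall u, U u -> f w0 <= f u) ->
  D° x0 -> A *m x0 + B *m w0 = 0 ->
  forall K : set 'cV[R]_d, compact K -> K `<=` D -> K° !=set0 ->
    admissible A B U K D /\
    inv_pressure A B U f K D =
      (\sum_(l \in spectrum A) Num.max 0 ((alg_mult A l)%:R * complex.Re l)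
       + f w0)%:E.
Proof.
move=> cAB hA cU _ DD _ cf Uw0 fmin Dx0 eq0 K cK KD [xK KxK].
have Dx : D x0 by exact: interior_subset.
split.
  split => //; [by exists xK; exact: interior_subset|by exists x0|].
  (* Admissibility is the controlled invariance of [D], restricted to [K]. *)
  by move=> x /KD; exact: DD.1.1.
have [P Pu hT] := complexify_trig A.
have [CD CD0 HCD] := control_set_bounded cU hA DD.1 Dx.
have /nbhs_normP [rK /= rK0 HK] := KxK.
have {}HK x : `|xK - x| < rK -> K x by exact: HK.
rewrite (spectrum_sum Pu hT); apply/eqP; rewrite eq_le; apply/andP; split.
  exact: (inv_pressure_le cU cAB DD cf Uw0 Dx0 eq0 cK KD Pu hT).
exact: (@inv_pressure_ge R d m A B U D f w0 cU cf fmin CD CD0 HCD K xK rK rK0 HK P Pu hT).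
Qed.
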